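(* For every network $Q$ with root $O$ (satisfying the standing assumption in the context), the deterministic expanding competitive ratio $\sigma=\sigma(Q)$ and the randomized expanding competitive ratio $\rho=\rho(Q)$ satisfy $$\frac{\sigma}{2}\le\rho\le\sigma .$$ Furthermore, both bounds are tight in the sense that they are the best possible: no constant larger than $1/2$ can replace $1/2$ in the left inequality, and no constant smaller than $1$ can be inserted in front of $\sigma$ in the right inequality, if the inequalities are to hold for all rooted networks.
   Context: A network $Q$ is a connected metric graph made of vertices and arcs (possibly unbounded), with a distinguished root vertex $O$, endowed with Lebesgue (length) measure $\lambda$; $\mu=\lambda(Q)\in(0,\infty]$ is its total measure. $d(x,y)$ is the length of a shortest path from $x$ to $y$, and $d(x)=d(O,x)$. Standing assumption: there is an integer $N$ such that $|\{x\in Q: d(x)=r\}|\le N$ for all $r>0$. An expanding search is a family of connected subsets $S(t)\subset Q$, $0\le t\le\mu$ ($t<\infty$), with $S(0)=\{O\}$, $S(t)\subset S(t')$ for $t\le t'$, and $\lambda(S(t))=t$ for all $t$. The search time of $H\in Q$ is $T(S,H)=\min\{t: H\in S(t)\}$; the normalized search time is $\hat T(S,H)=T(S,H)/d(H)$ for $H\ne O$, and $\hat T(S,O)=0$. The deterministic competitive ratio is $\sigma(Q)=\inf_S\sup_{H\in Q}\hat T(S,H)$ over expanding searches $S$. A randomized search $s$ is a probability distribution over expanding searches; $\hat T(s,H)$ is the expectation of $\hat T(S,H)$ with $S$ drawn from $s$; $\rho_s(Q)=\sup_{H\in Q}\hat T(s,H)$ and $\rho(Q)=\inf_s\rho_s(Q)$.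 *)

(* Defs.v *)
From HB Require Import structures.
From mathcomp Require Import all_boot all_order all_algebra.
From mathcomp Require Import all_classical all_reals all_analysis.
From mathcomp Require Import measurable_realfun.

Set Implicit Arguments.
Unset Strict Implicit.
Unset Printing Implicit Defensive.

Import Order.TTheory GRing.Theory Num.Theory.

Local Open Scope classical_set_scope.
Local Open Scope ring_scope.
Local Open Scope ereal_scope.

(* Vertices and arcs may be infinite in number; loops and parallel arcs are
   allowed. The arc e is parametrized by arc length, from parameter 0 at
   [arc_src e]; a bounded arc ends at [arc_tgt e], an arc of infinite length is
   a half-line and has no second end. *)
Record metric_graph (R : realType) := MetricGraph {
  vertex : choiceType;
  arc : choiceType;
  arc_length : arc -> \bar R;
  arc_src : arc -> vertex;
  arc_tgt : arc -> option vertex;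
  arc_length_gt0 : forall e, 0 < arc_length e;
  arc_tgt_unbounded : forall e, arc_tgt e = None <-> arc_length e = +oo }.

Inductive location (R : realType) (G : metric_graph R) :=
| AtVertex of vertex G
| Inside (e : arc G) (a : R) of (0%R < a)%R & a%:E < arc_length e.

Section MetricGraphTheory.
Variables (R : realType) (G : metric_graph R).

HB.instance Definition _ := gen_eqMixin (location G).
HB.instance Definition _ := gen_choiceMixin (location G).

(* x is the point of the closed arc e with parameter a. *)
Definition on_arc (e : arc G) (a : R) (x : location G) : Prop :=
  match x with
  | AtVertex v => (a = 0%R /\ arc_src e = v) \/
                  (a%:E = arc_length e /\ arc_tgt e = Some v)
  | Inside e' a' _ _ => e' = e /\ a' = a
  end.

(* [walk x y l]: some path of length l from x to y, made of finitely many
   segments each contained in an arc. *)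
Inductive walk : location G -> location G -> R -> Prop :=
| walk_nil x : walk x x 0%R
| walk_cons e a b x y z l : on_arc e a x -> on_arc e b y ->
    walk y z l -> walk x z (`|a - b| + l)%R.

Lemma walk_cat x y z l m : walk x y l -> walk y z m -> walk x z (l + m)%R.
Proof.
elim=> [u|e a b u v w k eu ev _ IH] wm; first by rewrite add0r.
by rewrite -addrA; apply: walk_cons eu ev (IH wm).
Qed.

Lemma walk_sym x y l : walk x y l -> walk y x l.
Proof.
elim=> [u|e a b u v w k eu ev _ IH]; first exact: walk_nil.
rewrite addrC; apply: walk_cat IH _; rewrite distrC -[`|_|%R]addr0.
exact: walk_cons ev eu (walk_nil u).
Qed.

Lemma walk_ge0 x y l : walk x y l -> (0 <= l)%R.
Proof. by elim=> // e a b u v w k _ _ _ k0; rewrite addr_ge0. Qed.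

(* An infimum, since in an arbitrary infinite graph a shortest path may not exist. *)
Definition dist (x y : location G) : R := inf [set l | walk x y l].

(* The topology is that of [dist]; see [walk_ball_dist]. Phrasing the balls with
   walks gives a pseudometric also when some points are not joined by a walk. *)
Definition walk_ball (x : location G) (r : R) : set (location G) :=
  [set y | exists2 l, walk x y l & (l < r)%R].

Lemma walk_ball_dist x y r : (exists l, walk x y l) ->
  walk_ball x r y <-> (dist x y < r)%R.
Proof.
move=> [l0 w0]; have lb : has_inf [set l | walk x y l].
  by split; [exists l0 | exists 0%R => l /walk_ge0].
split=> [[l wl]|]; first by apply: le_lt_trans; apply: ge_inf => //; case: lb.
by move=> /(inf_lt lb.1)[l wl lr]; exists l.
Qed.

HB.instance Definition _ :=
  hasNbhs.Build (location G) (nbhs_ (entourage_ walk_ball)).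

Let ball_center x (r : R) : (0 < r)%R -> walk_ball x r x.
Proof. by exists 0%R => //; exact: walk_nil. Qed.

Let ball_sym x y (r : R) : walk_ball x r y -> walk_ball y r x.
Proof. by move=> [l /walk_sym ? ?]; exists l. Qed.

Let ball_triangle x y z (r s : R) :
  walk_ball x r y -> walk_ball y s z -> walk_ball x (r + s) z.
Proof.
move=> [l wl lr] [m wm ms]; exists (l + m)%R; first exact: walk_cat wm.
exact: ltrD.
Qed.

HB.instance Definition _ := @Nbhs_isPseudoMetric.Build R (location G)
  (entourage_ walk_ball) erefl walk_ball ball_center ball_sym ball_triangle
  erefl.

(* Vertices do not contribute to length. Traces on arcs of the sets measured
   below (connected sets) are Borel. *)
Definition total_length (A : set (location G)) : \bar R :=
  \esum_(e in [set: arc G])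
    lebesgue_measure [set a : R | [/\ (0 < a)%R, a%:E < arc_length e &
                                      exists2 x, A x & on_arc e a x]].

End MetricGraphTheory.

Record network (R : realType) := Network {
  graph :> metric_graph R;
  root : vertex graph;
  network_connected : forall x y : location graph, exists l, walk x y l;
  network_length_gt0 : 0 < total_length [set: location graph] }.

Section Search.
Variables (R : realType) (Q : network R).

Definition origin : location Q := AtVertex (root Q).

Definition bounded_spheres : Prop :=
  exists N : nat, forall r : R, (0 < r)%R ->
    ([set x | dist origin x = r] #<= `I_N)%card.

Definition network_length : \bar R := total_length [set: location Q].

(* Only the values of S at 0 <= t <= network_length are meaningful. *)
Record search := Search {
  explored :> R -> set (location Q);
  explored0 : explored 0%R = [set origin];
  explored_mono : forall t t' : R, (0 <= t)%R -> (t <= t')%R ->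
    t'%:E <= network_length -> explored t `<=` explored t';
  explored_connected : forall t : R, (0 <= t)%R -> t%:E <= network_length ->
    connected (explored t);
  explored_length : forall t : R, (0 <= t)%R -> t%:E <= network_length ->
    total_length (explored t) = t%:E }.

(* An infimum, since the least t need not exist (S may be open at time t);
   +oo if H is never found. *)
Definition search_time (S : search) (H : location Q) : \bar R :=
  ereal_inf [set t%:E | t in
    [set t : R | [/\ (0 <= t)%R, t%:E <= network_length & S t H]]].

Definition normalized_time (S : search) (H : location Q) : \bar R :=
  if H == origin then 0 else search_time S H * ((dist origin H)^-1)%:E.

Definition deterministic_ratio : \bar R :=
  ereal_inf [set ereal_sup [set normalized_time S H | H in [set: location Q]]
            | S in [set: search]].

(* The set of searches, pointed at S0 because measurable types of the library
   are pointed. *)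
Definition search_space (S0 : search) : Type := search.

HB.instance Definition _ (S0 : search) := gen_eqMixin (search_space S0).
HB.instance Definition _ (S0 : search) := gen_choiceMixin (search_space S0).
HB.instance Definition _ (S0 : search) := isPointed.Build (search_space S0) S0.

(* Generators of the coarsest sigma-algebra for which the search time of every
   point is a random variable. *)
Definition search_events (S0 : search) : set (set (search_space S0)) :=
  \bigcup_(H in [set: location Q])
    preimage_set_system [set: search_space S0]
      (fun S => search_time S H) measurable.

Record randomized_search := RandomizedSearch {
  base_search : search;
  search_law :>
    probability (g_sigma_algebraType (@search_events base_search)) R }.

Definition expected_time (s : randomized_search) (H : location Q) : \bar R :=
  \int[search_law s]_S normalized_time S H.

Definition randomized_ratio : \bar R :=
  ereal_inf [set ereal_sup [set expected_time s H | H in [set: location Q]]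
            | s in [set: randomized_search]].

End Search.

(* Main.v *)
From HB Require Import structures.
From mathcomp Require Import all_boot all_order all_algebra.
From mathcomp Require Import all_classical all_reals all_analysis.
From mathcomp Require Import measurable_realfun.
From mathcomp Require Import lra ring.
Require Import Defs.

Set Implicit Arguments.
Unset Strict Implicit.
Unset Printing Implicit Defensive.

Import Order.TTheory GRing.Theory Num.Theory.
Import numFieldNormedType.Exports.

Local Open Scope classical_set_scope.
Local Open Scope ring_scope.

(** Write g r for the length of the open ball of radius r around the root.  Up
    to a factor 2, both ratios are the supremum of g r / r over r > 0.

    A breadth-first search, which has explored the ball of radius r at time
    g r, finds a point at distance d from the root at time at most g r for
    every r > d.  If g r <= K r for all r, its competitive ratio is therefore
    at most K ([deterministic_ratio_le]).  That it is an expanding search needs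
    g to be continuous.  Continuity from the right holds because a sphere is
    finite, hence of length zero, and because, once g is finite, finitely many
    arcs carry almost all the length ([ball_length_right_cont]).

    Against a randomized search, hide uniformly in the ball of radius r: a
    fixed search has explored length at most t at time t, so it needs at least
    g r / 2 on average, while the normalization divides by less than r.  Hence
    g r <= 2 r rho ([ball_length_le_ratio]), and with the previous bound
    sigma <= 2 rho.  Averaging over a continuous hiding place would call for
    joint measurability of the search time in the search and the point; here
    the hiding place is uniform on finitely many points spaced by delta along
    finitely many arcs ([sample_points]).  A connected set that contains the
    root can enter the interior of an arc only from its ends, so what it leaves
    of the arc is an interval ([trace_reaches_side]); therefore a set of length
    t contains at most t / delta of the points, up to one point per arc, and
    the k-th point found is found no earlier than about k delta
    ([sum_search_time_ge]).  The error vanishes with delta.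

    The inequality rho <= sigma holds because a deterministic search is a
    randomized search with a Dirac law.

    Sharpness comes from brooms: a handle of length 1 from the root to a hub,
    with n bristles of length eps at the hub.  All points are within 1 + eps of
    the root, so sigma >= (1 + n eps) / (1 + eps).  Visiting the bristles in
    some order or in the reverse one, with probability 1/2 each, every bristle
    waits on average for half of the others, so rho <= 1 + n eps / 2.  For
    n = m ^ 2 and eps = 1 / m these bounds are m and 1 + m / 2, whose quotient
    tends to 1/2.  A broom without bristles is a segment, with both ratios
    equal to 1. *)

(** * Lipschitz functions on a metric graph *)

Section Arcs.
Variables (R : realType) (G : metric_graph R).
Implicit Types (x y z : location G) (e : arc G) (a b c l : R).

(** It is enough to compare points of a common arc, since a walk is a chain of
    segments of arcs. *)
Definition arc_lipschitz (f : location G -> R) : Prop :=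
  forall e a b x y, on_arc e a x -> on_arc e b y ->
    `|f x - f y| <= `|a - b|.

Lemma arc_lipschitz_walk f x y l : arc_lipschitz f -> walk x y l ->
  `|f x - f y| <= l.
Proof.
move=> lf; elim=> [u|e a b u v w k eu ev _ IH]; first by rewrite subrr normr0.
by rewrite -(subrKA (f v)); apply: (le_trans (ler_normD _ _)); rewrite lerD// (lf e).
Qed.

Lemma arc_lipschitz_continuous f : arc_lipschitz f -> continuous f.
Proof.
move=> lf x; have fx : Filter (nbhs x) by exact: nbhs_filter.
apply/cvgrPdist_lt => eps eps0.
apply: (@filterS _ (nbhs x) _ (ball x eps)); last exact: nbhsx_ballx.
by move=> y [l wl lr]; apply: le_lt_trans lr; exact: arc_lipschitz_walk wl.
Qed.

(** An intermediate value theorem: the source of all statements that a connected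
    set cannot jump over part of an arc. *)
Lemma connected_attains f (S : set (location G)) x y c :
  arc_lipschitz f -> connected S -> S x -> S y -> (f x <= c <= f y) ->
  exists2 z, S z & f z = c.
Proof.
move=> /arc_lipschitz_continuous cf cS Sx Sy xcy.
have /connected_intervalP : connected (f @` S).
  by apply: connected_continuous_connected => //; exact: continuous_subspaceT.
move=> /(_ (f x) (f y) _ _ c xcy)[||z Sz <-]; [by exists x|by exists y|].
by exists z.
Qed.

Lemma on_arc_inj e a x y : on_arc e a x -> on_arc e a y -> x = y.
Proof.
have bnd e' a' : 0 < a' -> (a'%:E < arc_length e')%E ->
    ~ (a' = 0) /\ ~ (a'%:E = arc_length e').
  move=> h1 h2; split=> h'; first by rewrite h' ltxx in h1.
  by rewrite h' ltxx in h2.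
case: x y => [v|e1 a1 p1 q1] [w|e2 a2 p2 q2] /=.
- move=> [[-> <-]|[h hv]] [[h' <-]|[h' hw]] //.
  + by have := arc_length_gt0 e; rewrite -h' ltxx.
  + by have := arc_length_gt0 e; rewrite -h h' ltxx.
  + by move: hw; rewrite hv => -[->].
- move=> H [? ?]; subst; have [h1 h2] := bnd _ _ p2 q2.
  by case: H => -[h _]; [case: h1|case: h2].
- move=> [? ?] H; subst; have [h1 h2] := bnd _ _ p1 q1.
  by case: H => -[h _]; [case: h1|case: h2].
move=> [? ?] [? ?]; subst; congr Inside; exact: Prop_irrelevance.
Qed.

Lemma on_arc_bounds e a x : on_arc e a x -> 0 <= a /\ (a%:E <= arc_length e)%E.
Proof.
case: x => [v|e' a' p q] /= => [[[-> _]|[h _]]|[<- <-]].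
- by split=> //; exact/ltW/arc_length_gt0.
- by split; [rewrite -lee_fin h; exact/ltW/arc_length_gt0|rewrite h].
by split; exact: ltW.
Qed.

Lemma on_arc_exists e a : 0 <= a -> (a%:E <= arc_length e)%E ->
  exists x, on_arc e a x.
Proof.
rewrite le_eqVlt => /predU1P[<- _|a0].
  by exists (AtVertex (arc_src e)); left.
rewrite le_eqVlt => /predU1P[h|al]; last by exists (Inside a0 al).
case E : (arc_tgt e) => [v|]; first by exists (AtVertex v); right.
by move: E => /arc_tgt_unbounded; rewrite -h.
Qed.

Lemma on_arc_inside e a x : 0 < a -> (a%:E < arc_length e)%E ->
  on_arc e a x -> exists h h', x = @Inside R G e a h h'.
Proof.
by move=> h h' ex; exists h, h'; exact: on_arc_inj ex _.
Qed.

(** A tent over the segment from p to q of the arc e.  A positive level below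
    its top is attained at exactly two points, both inside e. *)
Definition hump e p q x : R :=
  if x is Inside e' a _ _ then
    if e' == e then Num.max 0 (Num.min (a - p) (q - a)) else 0
  else 0.

Lemma hump_lipschitz e p q : 0 <= p -> (q%:E <= arc_length e)%E ->
  arc_lipschitz (hump e p q).
Proof.
move=> p0 qe e' a b x y ex ey.
pose m (c : R) : R := Num.max 0 (Num.min (c - p) (q - c)).
have hm c z : on_arc e' c z -> hump e p q z = if e' == e then m c else 0.
  case: z => [v|e1 c' ? ?] /=; last by move=> [-> ->].
  case: eqP => // -> [[-> _]|[h _]]; apply/esym/max_idPl.
    by rewrite ge_min; apply/orP; left; lra.
  by rewrite ge_min; apply/orP; right; move: qe; rewrite -h lee_fin; lra.
rewrite (hm _ _ ex) (hm _ _ ey); case: eqP => _; last by rewrite subrr normr0.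
rewrite /m /Num.max /Num.min.
repeat case: ifP; rewrite ?ltNge; 
 do ? (move=> /negP/negP || move=> /negbFE || move=> /negbT);
 rewrite -?ltNge => *; rewrite ler_norml;
 have := ler_norm (a - b); have := ler_norm (b - a);
 rewrite (distrC b a) => *; apply/andP; split; lra.
Qed.

End Arcs.

(** * How a connected set meets an arc *)

Section Traces.
Variables (R : realType) (G : metric_graph R).
Implicit Types (x y z : location G) (e : arc G) (S A B : set (location G)).

(** By definition, the total length of S is the sum over the arcs e of the
    Lebesgue measure of [trace S e]. *)
Definition trace S e : set R :=
  [set a | [/\ 0 < a, (a%:E < arc_length e)%E & exists2 x, S x & on_arc e a x]].

Lemma traceP S e a (a0 : 0 < a) (al : (a%:E < arc_length e)%E) :
  trace S e a <-> S (Inside a0 al).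
Proof.
split=> [[_ _ [x Sx ex]]|Sa]; last by split=> //; exists (Inside a0 al).
by rewrite (on_arc_inj (_ : on_arc e a (Inside a0 al)) ex).
Qed.

(** A tent on the arc is 0 at the vertex v of S.  If it takes the value eta at
    a1 and a2 only, and more than eta at b, the connected set S attains the
    level eta on the way from v to b, that is, at a1 or at a2. *)
Lemma trace_reaches_side S e v a1 b a2 : connected S -> S (AtVertex v) ->
  0 < a1 -> (a2%:E < arc_length e)%E -> a1 < b < a2 ->
  trace S e b -> trace S e a1 \/ trace S e a2.
Proof.
move=> cS Sv a1_gt0 a2l /andP[a1b ba2] [b0 bl [x Sx ex]].
have [c a2c cl] : exists2 c, a2 < c & (c%:E <= arc_length e)%E.
  case: (arc_length e) a2l => [l|_|//]; first by exists l.
  by exists (a2 + 1); rewrite ?leey// ltrDl.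
(* eta is small enough for a tent over [a1 - eta, a2 + eta] to fit in the arc *)
pose eta := Num.min a1 (c - a2).
have eta0 : 0 < eta by rewrite lt_min a1_gt0 subr_gt0.
have [ea1 eac] : eta <= a1 /\ eta <= c - a2.
  by split; rewrite ge_min lexx ?orbT.
have pq : (0 <= a1 - eta) && ((a2 + eta)%:E <= arc_length e)%E.
  rewrite subr_ge0 ea1/=; apply: le_trans cl; rewrite lee_fin; lra.
have /andP[p0 ql] := pq.
have hx : eta <= hump e (a1 - eta) (a2 + eta) x.
  case: x ex {Sx} => [w|e' b' ? ?] /=.
    move=> [[b0' _]|[bl' _]]; first by move: b0; rewrite b0' ltxx.
    by move: bl; rewrite bl' ltxx.
  move=> [-> ->]; rewrite eqxx le_max; apply/orP; right; rewrite le_min.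
  by apply/andP; split; lra.
have [|z Sz] := connected_attains (hump_lipschitz p0 ql) cS Sv Sx (c := eta).
  by rewrite hx andbT /=; exact: ltW.
case: z Sz => [w _|e' b' h h' Sb] /=; first by move=> h; move: eta0; rewrite -h ltxx.
case: eqP => [ee|_ h0]; last by move: eta0; rewrite -h0 ltxx.
subst e'; rewrite /Num.max /Num.min.
have tb a : b' = a -> trace S e a by move=> <-; apply/(traceP S h h').
case: ifP => // _; last by move=> h0; move: eta0; rewrite -h0 ltxx.
by case: ifP => _ h0; [left|right]; apply: tb; lra.
Qed.

(** The complement of the trace in the arc is an interval. *)
Lemma trace_measurable S v e : connected S -> S (AtVertex v) ->
  measurable (trace S e).
Proof.
move=> cS Sv; pose L := [set a : R | 0 < a /\ (a%:E < arc_length e)%E].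
have iL : is_interval L.
  move=> a b [a0 _] [_ bl] c /andP[ac cb]; split; first exact: lt_le_trans ac.
  by apply: le_lt_trans bl; rewrite lee_fin.
have iC : is_interval (L `\` trace S e).
  move=> a b [La na] [Lb nb] c /andP[]; rewrite le_eqVlt => /predU1P[<-//|ac].
  rewrite le_eqVlt => /predU1P[->//|cb]; split.
    by apply: (iL a b) => //; rewrite !ltW.
  move=> /(trace_reaches_side cS Sv La.1 Lb.2).
  by rewrite ac cb => /(_ isT)[].
have -> : trace S e = L `\` (L `\` trace S e).
  rewrite setDD; apply/seteqP; split=> [a ta|a []//].
  by split=> //; case: ta.
by apply: measurableD; exact: is_interval_measurable.
Qed.

Lemma traceS A B e : A `<=` B -> trace A e `<=` trace B e.
Proof. by move=> AB a [? ? [x /AB ? ?]]; split=> //; exists x. Qed.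

(** The segment is the continuous image of an interval under the parametrization
    of the arc, which [xget] turns from a relation into a function. *)
Lemma connected_arc_segment e a b : 0 <= a -> (b%:E <= arc_length e)%E ->
  connected [set x | exists2 c, a <= c <= b & on_arc e c x].
Proof.
move=> a0 bl; pose g c := xget (AtVertex (arc_src e)) (on_arc e c).
have gP c : c \in `[a, b] -> on_arc e c (g c).
  rewrite in_itv/= => /andP[ac cb]; case: (@on_arc_exists _ _ e c) => [||x ex].
  - exact: le_trans ac.
  - by apply: le_trans bl; rewrite lee_fin.
  by rewrite /g; apply: xgetPex; exists x.
have -> : [set x | exists2 c, a <= c <= b & on_arc e c x] = g @` `[a, b].
  apply/seteqP; split=> [x [c cab ex]|_ [c cab <-]].
    by exists c; rewrite /= ?in_itv//; apply: on_arc_inj ex; exact/gP.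
  by exists c; [move: cab; rewrite /= in_itv|exact/gP].
apply: connected_continuous_connected.
  by apply/connected_intervalP; exact: interval_is_interval.
apply/subspace_continuousP => c /= cab.
have fc : Filter (within `[a, b] (nbhs c)) by exact: within_filter.
apply/cvg_ballP => eps eps0; rewrite near_withinE.
near=> d => dab; exists `|c - d|.
  by rewrite -[X in walk _ _ X]addr0; apply: walk_cons (walk_nil _); exact/gP.
near: d; apply: (@filterS _ (nbhs c) _ (ball c eps)) => //; exact: nbhsx_ballx.
Unshelve. all: by end_near. Qed.

(** C is the set of points that the walk runs through. *)
Lemma walk_connected x y l : walk x y l ->
  exists C, [/\ connected C, C x, C y &
                forall z, C z -> exists2 m, walk x z m & m <= l].
Proof.
elim=> [u|e a b u v w k eu ev wvw [C [cC Cv Cw HC]]].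
  exists [set u]; split=> // [|z ->]; first exact: connected1.
  by exists 0 => //; exact: walk_nil.
have [[a0 al] [b0 bl]] := (on_arc_bounds eu, on_arc_bounds ev).
pose D := [set x | exists2 c, Num.min a b <= c <= Num.max a b & on_arc e c x].
have cD : connected D.
  by apply: connected_arc_segment; rewrite ?le_min ?a0// EFin_max ge_max al.
have Dv : D v by exists b => //; rewrite ge_min le_max lexx !orbT.
exists (D `|` C); split; [|left|by right|].
- by apply: connectedU => //; exists v.
- by exists a => //; rewrite ge_min le_max lexx.
move=> z [[c cab ez]|Cz].
  exists (`|a - c| + 0); first by apply: walk_cons eu ez (walk_nil _).
  rewrite lerD// ?(walk_ge0 wvw)//.
  move: cab; rewrite /Num.min /Num.max; case: ifP => [|/negbT];
    rewrite -?leNgt => h /andP[h1 h2].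
    by rewrite ler0_norm ?ler0_norm; lra.
  by rewrite !ger0_norm; lra.
have [m wm mk] := HC z Cz; exists (`|a - b| + m); last by rewrite lerD2l.
exact: walk_cons eu ev wm.
Qed.

Lemma walk_ball_connected x r : connected (walk_ball x r).
Proof.
have [r0|r0] := ltP 0 r; last first.
  rewrite (_ : walk_ball x r = set0); first exact: connected0.
  apply/seteqP; split=> // y [l wl lr].
  by have := le_lt_trans (walk_ge0 wl) (lt_le_trans lr r0); rewrite ltxx.
pose F C := [/\ connected C, C x & C `<=` walk_ball x r].
rewrite (_ : walk_ball x r = \bigcup_(C in F) C).
  by apply: bigcup_connected => [|C []//]; exists x => C [].
apply/seteqP; split=> [y [l wl lr]|y [C [_ _ +] Cy]]; last exact.
have [C [cC Cx Cy HC]] := walk_connected wl; exists C => //; split=> // z /HC.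
by move=> [m wm ml]; exists m => //; exact: le_lt_trans lr.
Qed.

End Traces.

(** * Counting equally spaced points *)

(** T stands for the trace on an arc of length L of a connected set that contains
    the root; [T_gap] says that T can only extend from the ends of the arc.  Such
    a T is estimated by the number of nodes, the positive multiples of delta,
    that it contains. *)
Section Grid.
Variables (R : realType) (T : set R) (L : \bar R) (delta : R).
Hypothesis mT : measurable T.
Hypothesis T_dom : forall a, T a -> 0 < a /\ (a%:E < L)%E.
Hypothesis T_gap : forall a1 b a2, 0 < a1 -> (a2%:E < L)%E -> a1 < b < a2 ->
  T b -> T a1 \/ T a2.
Hypothesis delta_gt0 : 0 < delta.
Local Notation mu := (@lebesgue_measure R).

Definition node (k : nat) : R := k%:R * delta.
Definition cell (k : nat) : set R := `]node k, node k.+1]%classic.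
(** Nodes are counted from 1: the k-th cell is matched with its right end. *)
Definition grid_count (M : nat) : nat := \sum_(k < M) `[< T (node k.+1) >].

Lemma nodeS k : node k.+1 = node k + delta.
Proof. by rewrite /node -natr1 mulrDl mul1r. Qed.

Lemma node_le j k : (j <= k)%N -> node j <= node k.
Proof. by move=> jk; rewrite ler_pM2r// ler_nat. Qed.

Lemma measurable_cell k : measurable (T `&` cell k).
Proof. by apply: measurableI => //; exact: measurable_itv. Qed.

Lemma measurable_cells M : measurable (T `&` `]0, node M]).
Proof. by apply: measurableI => //; exact: measurable_itv. Qed.

Lemma mu_cell k : mu (cell k) = delta%:E.
Proof.
rewrite /cell lebesgue_measure_itv/= lte_fin nodeS ltrDl delta_gt0.
by rewrite -EFinB addrAC subrr add0r.
Qed.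

Lemma mu_cells M :
  mu (T `&` `]0, node M]) = (\sum_(k < M) mu (T `&` cell k))%E.
Proof.
elim: M => [|M IH].
  by rewrite big_ord0 /node mul0r set_itvoc0 setI0 measure0.
have := node_le (leq0n M); rewrite {1}/node mul0r => h0.
have hS : node M <= node M.+1 by exact: node_le.
rewrite big_ord_recr/= -IH -measureU.
- rewrite -setIUr; congr (mu (T `&` _)); apply/seteqP.
  split=> a; rewrite /cell /= !in_itv/=.
    by move=> /andP[-> ->]; case: (leP a (node M)); [left|right].
  move=> [/andP[-> h]|/andP[h ->]]; first by rewrite (le_trans h).
  by rewrite (le_lt_trans h0).
- exact: measurable_cells.
- exact: measurable_cell.
- rewrite setIACA setIid (_ : `]0, node M] `&` cell M = set0) ?setI0//.
  apply/seteqP; split=> // a []; rewrite /cell /= !in_itv/= => /andP[_ h] /andP[h' _].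
  by have := lt_le_trans h' h; rewrite ltxx.
Qed.

Lemma sum_at_most_one M (P : 'I_M -> Prop) :
  (forall j k : 'I_M, (j < k)%N -> P j -> P k -> False) ->
  (\sum_(k < M) `[< P k >] <= 1)%N.
Proof.
move=> h; rewrite -big_mkcond/= sum1_card; apply/card_le1_eqP.
move=> j k /asboolP Pj /asboolP Pk.
case: (ltngtP j k) => [jk|kj|/val_inj//]; first by case: (h _ _ jk Pj Pk).
by case: (h _ _ kj Pk Pj).
Qed.

(** A node of T whose cell is not contained in T is where T, coming from the far
    end of the arc, stops: this happens at most once. *)
Lemma grid_count_le M : ((delta *+ grid_count M)%:E <= mu T + delta%:E)%E.
Proof.
pose bad (k : 'I_M) := T (node k.+1) /\ exists2 b, cell k b & ~ T b.
pose good (k : 'I_M) := T (node k.+1) /\ cell k `<=` T.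
have bad1 : (\sum_(k < M) `[< bad k >] <= 1)%N.
  apply: sum_at_most_one => j k jk [Tj [b bj nb]] [Tk [c ck nc]].
  move: bj ck; rewrite /cell/= !in_itv/= => /andP[jb]; rewrite le_eqVlt.
  move=> /predU1P[bj|bj]; first by rewrite bj in nb.
  move=> /andP[kc ck]; have jc : node j.+1 < c by apply: le_lt_trans kc; exact: node_le.
  case: (@T_gap b (node j.+1) c) => //; last by rewrite bj.
    by apply: le_lt_trans jb; rewrite mulr_ge0// ltW.
  by apply: le_lt_trans (T_dom Tk).2; rewrite lee_fin.
have gb : (grid_count M <= \sum_(k < M) `[< good k >] + 1)%N.
  apply: leq_trans (_ : _ <= \sum_(k < M) `[< good k >] + \sum_(k < M) `[< bad k >])%N _.
    rewrite -big_split/=; apply: leq_sum => k _; case: asboolP => // Tk.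
    have [gk|ngk] := pselect (good k); first by rewrite (asboolT gk).
    rewrite [X in (_ + nat_of_bool X)%N]asboolT ?leq_addl//; split=> //.
    apply: contrapT => nex; apply: ngk; split=> // b kb.
    by apply: contrapT => nb; apply: nex; exists b.
  by rewrite leq_add2l.
apply: (@le_trans _ _ ((delta *+ (\sum_(k < M) `[< good k >] + 1))%:E)).
  by rewrite lee_fin ler_wpMn2l// ltW.
rewrite mulrnDr mulr1n EFinD leeD2r//.
apply: (@le_trans _ _ (mu (T `&` `]0%R, node M]))); last first.
  by apply: le_measure; rewrite ?inE//; exact: measurable_cells.
rewrite mu_cells -sumrMnr -sumEFin; apply: lee_sum => k _.
case: asboolP => [[Tk kT]|_]; last by rewrite mulr0n.
by rewrite mulr1n (_ : T `&` cell k = cell k) ?mu_cell//; apply/setIidPr.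
Qed.

(** A cell that meets T while its node is outside T either contains the point
    where T, coming from the source of the arc, stops, or contains the far end of
    the arc: hence the 2. *)
Lemma grid_count_ge M :
  (mu (T `&` `]0%R, node M]) <= (delta *+ (grid_count M + 2))%:E)%E.
Proof.
pose bad (k : 'I_M) := (exists2 b, cell k b & T b) /\ ~ T (node k.+1).
pose bad1 (k : 'I_M) := bad k /\ ((node k.+1)%:E < L)%E.
pose bad2 (k : 'I_M) := bad k /\ (L <= (node k.+1)%:E)%E.
have b1 : (\sum_(k < M) `[< bad1 k >] <= 1)%N.
  apply: sum_at_most_one => j k jk [[_ nj] lj] [[[c ck Tc] nk] lk].
  move: ck; rewrite /cell/= in_itv/= => /andP[kc]; rewrite le_eqVlt => /predU1P[e|ck].
    by apply: nk; rewrite -e.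
  case: (@T_gap (node j.+1) c (node k.+1)) => //.
    by rewrite mulr_gt0.
  by rewrite ck andbT; apply: le_lt_trans kc; exact: node_le.
have b2 : (\sum_(k < M) `[< bad2 k >] <= 1)%N.
  apply: sum_at_most_one => j k jk [_ lj] [[[c ck Tc] _] _].
  move: ck; rewrite /cell/= in_itv/= => /andP[kc _].
  have := lt_le_trans (T_dom Tc).2 lj; rewrite lte_fin => cj.
  by have := lt_le_trans (lt_trans kc cj) (node_le jk); rewrite ltxx.
rewrite mu_cells.
apply: (@le_trans _ _ (delta *+ (grid_count M +
    (\sum_(k < M) `[< bad1 k >] + \sum_(k < M) `[< bad2 k >])))%:E); last first.
  by rewrite lee_fin ler_wpMn2l ?(ltW delta_gt0)// leq_add2l (leq_add b1 b2).
rewrite /grid_count -!big_split/= -sumrMnr -sumEFin; apply: lee_sum => k _.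
have mle : (mu (T `&` cell k) <= delta%:E)%E.
  rewrite -(mu_cell k); apply: le_measure; rewrite ?inE//.
    exact: measurable_cell.
  exact: measurable_itv.
have [Tk|nTk] := pselect (T (node k.+1)).
  rewrite (asboolT Tk); apply: (le_trans mle).
  by rewrite lee_fin -[X in X <= _]mulr1n ler_wpMn2l ?(ltW delta_gt0).
have [bk|nbk] := pselect (exists2 b, cell k b & T b); last first.
  rewrite (_ : T `&` cell k = set0) ?measure0 ?lee_fin ?mulrn_wge0 ?ltW//.
  by apply/seteqP; split=> // b [Tb kb]; apply: nbk; exists b.
apply: (le_trans mle); rewrite lee_fin -[X in X <= _]mulr1n ler_wpMn2l ?(ltW delta_gt0)//.
rewrite (asboolF nTk) add0n; case: (ltP (node k.+1)%:E L) => h.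
  by rewrite (@asboolT (bad1 k)).
by rewrite (@asboolT (bad2 k)) ?leq_addl.
Qed.

End Grid.

Section TotalLength.
Variables (R : realType) (G : metric_graph R).
Implicit Types (A B : set (location G)) (s : seq (arc G)).
Local Notation mu := (@lebesgue_measure R).

Lemma total_length_ge A s : uniq s ->
  (\sum_(e <- s) mu (trace A e) <= total_length A)%E.
Proof.
move=> us; apply: esum_ge; exists [set` s] => //.
by rewrite (fsbig_seq _ _ us).
Qed.

Lemma total_length_le A c :
  (forall s, uniq s -> (\sum_(e <- s) mu (trace A e) <= c)%E) ->
  (total_length A <= c)%E.
Proof.
move=> h; apply: ge_ereal_sup => _ [X [fX _] <-].
by rewrite (fsbig_finite _ _ fX); apply: h; exact: finmap.fset_uniq.
Qed.

End TotalLength.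

Section Sampling.
Variables (R : realType) (Q : network R).
Implicit Types (e : arc Q) (F : seq (arc Q)) (S : set (location Q)).
Local Notation mu := (@lebesgue_measure R).
Local Notation ball r := (walk_ball (origin Q) r).

(** On an unbounded arc, the parameter extended by 0 is a Lipschitz function. *)
Lemma trace_ball_bounded e r :
  exists2 c, 0 < c & trace (ball r) e `<=` `]0, c].
Proof.
case E : (arc_length e) => [l| |]; last first.
- by have := arc_length_gt0 e; rewrite E.
- have lf : arc_lipschitz (fun x : location Q =>
      if x is Inside e' a _ _ then if e' == e then a else 0 else 0).
    move=> e' a b x y ex ey.
    have h c z : on_arc e' c z -> (if z is Inside e'' a' _ _ then
        if e'' == e then a' else 0 else 0) = if e' == e then c else 0.
      case: z => [v|e'' a' _ _] /=; last by move=> [-> ->].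
      by case: eqP => // -> [[-> _]|[]] //; rewrite E.
    by rewrite (h _ _ ex) (h _ _ ey); case: eqP => // _; rewrite subrr normr0.
  exists (Num.max 1 r); first by rewrite lt_max ltr01.
  move=> a [a0 _ [x [l wl lr] ex]]; rewrite /= in_itv/= a0/= le_max.
  apply/orP; right; apply: le_trans (ltW lr).
  have := arc_lipschitz_walk lf wl; case: x ex {wl} => [v|e' a' ? ?] /=.
    by move=> [[a00 _]|[]]; [rewrite a00 ltxx in a0|rewrite E].
  by move=> [-> ->]; rewrite eqxx sub0r normrN gtr0_norm.
exists l; first by rewrite -lte_fin -E arc_length_gt0.
move=> a [a0 + _]; rewrite E lte_fin /= in_itv/= a0 => /ltW al; exact: al.
Qed.

Lemma trace_ball_bounded_seq F r : exists2 c, 0 < c &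
  forall e, e \in F -> trace (ball r) e `<=` `]0, c].
Proof.
elim: F => [|e F [c c0 IH]]; first by exists 1.
have [d d0 dP] := trace_ball_bounded e r.
exists (Num.max c d); first by rewrite lt_max c0.
move=> e'; rewrite inE => /predU1P[->|/IH h] a; [move=> /dP|move=> /h];
  rewrite /= !in_itv/= => /andP[-> h']; rewrite le_max h' ?orbT//.
Qed.

Lemma dist_le x y l : @walk R Q x y l -> dist x y <= l.
Proof. by move=> wl; apply: ge_inf => //; exists 0 => m /walk_ge0. Qed.

Lemma dist_ge x y c : (forall l, @walk R Q x y l -> c <= l) -> c <= dist x y.
Proof.
move=> h; apply: lb_le_inf; last by move=> l /h.
have [l wl] := network_connected x y; by exists l.
Qed.

Lemma dist_inside_gt0 e a (a0 : 0 < a) (al : (a%:E < arc_length e)%E) :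
  0 < dist (origin Q) (Inside a0 al).
Proof.
have [c ac cl] : exists2 c, a < c & (c%:E <= arc_length e)%E.
  case: (arc_length e) al => [l|_|//]; first by exists l.
  by exists (a + 1); rewrite ?leey// ltrDl.
apply: (@lt_le_trans _ _ (Num.min a (c - a))); first by rewrite lt_min a0 subr_gt0.
apply: dist_ge => l wl; have := arc_lipschitz_walk (hump_lipschitz (lexx 0) cl) wl.
rewrite /= eqxx subr0 sub0r normrN; apply: le_trans.
by rewrite (le_trans _ (ler_norm _))// le_max lexx orbT.
Qed.

Lemma trace_shape (S : set (location Q)) e : connected S -> S (origin Q) ->
  [/\ measurable (trace S e),
      forall a, trace S e a -> 0 < a /\ (a%:E < arc_length e)%E &
      forall a1 b a2, 0 < a1 -> (a2%:E < arc_length e)%E -> a1 < b < a2 ->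
        trace S e b -> trace S e a1 \/ trace S e a2].
Proof.
move=> cS So; split; first exact: trace_measurable cS So.
- by move=> a [].
- by move=> a1 b a2; exact: trace_reaches_side cS So.
Qed.

(** The hiding places: the nodes of spacing delta that lie in the ball, on the
    arcs of F.  They nearly exhaust the length of the ball in F, and a connected
    set that contains the root cannot have many more of them than its length
    allows. *)
Lemma sample_points F r : uniq F -> 0 < r -> exists2 c, 0 < c &
  forall M, (0 < M)%N -> exists pts : seq (location Q),
  let delta := c / M%:R in
  [/\ forall H, H \in pts -> 0 < dist (origin Q) H < r,
      (\sum_(e <- F) mu (trace (ball r) e) <=
         (delta *+ (size pts + 2 * size F))%:E)%E &
      forall S, connected S -> S (origin Q) ->
        ((delta *+ count (fun H => `[< S H >]) pts)%:E <=
           total_length S + (delta *+ size F)%:E)%E].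
Proof.
move=> uF r0; have [c c0 cP] := trace_ball_bounded_seq F r.
exists c => // M M0; set delta := c / M%:R.
have d0 : 0 < delta by rewrite divr_gt0// ltr0n.
pose loc e k := xget (origin Q) (on_arc e (node delta k.+1)).
pose tb e k := trace (ball r) e (node delta k.+1).
have locP S e k : tb e k -> S (loc e k) <-> trace S e (node delta k.+1).
  move=> [n0 nl _]; have exk : on_arc e (node delta k.+1) (loc e k).
    by apply: xgetPex; exact: on_arc_exists (ltW n0) (ltW nl).
  split=> [Sk|[_ _ [x Sx /(on_arc_inj exk)->//]]].
  by split=> //; exists (loc e k).
pose pts e := [seq loc e k | k <- iota 0 M & `[< tb e k >]].
have Bo : ball r (origin Q) by exists 0 => //; exact: walk_nil.
have cB := @walk_ball_connected _ Q (origin Q) r.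
have count_iota (p : pred nat) : count p (iota 0 M) = (\sum_(k < M) p k)%N.
  by rewrite -sum1_count big_mkcond/= -{1}(subn0 M) -/(index_iota 0 M) big_mkord.
have szP e : size (pts e) = grid_count (trace (ball r) e) delta M.
  by rewrite size_map size_filter count_iota.
exists (flatten [seq pts e | e <- F]); split.
- move=> H /flatten_mapP[e eF /mapP[k]]; rewrite mem_filter => /andP[/asboolP tk _] ->.
  apply/andP; split; last by apply/walk_ball_dist; [exact: network_connected|exact/locP].
  have [n0 nl _] := tk; have exk : on_arc e (node delta k.+1) (loc e k).
    by apply: xgetPex; exact: on_arc_exists (ltW n0) (ltW nl).
  by rewrite (on_arc_inj exk (_ : on_arc e _ (Inside n0 nl))) ?dist_inside_gt0.
- apply: (@le_trans _ _ (\sum_(e <- F) (delta *+ (size (pts e) + 2))%:E)%E).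
    rewrite big_seq_cond [leRHS]big_seq_cond; apply: lee_sum => e /andP[eF _].
    have [mT Td Tg] := trace_shape e cB Bo.
    rewrite szP; have := grid_count_ge mT Td Tg d0 M.
    rewrite (_ : node delta M = c) ?(setIidl (cP e eF))//.
    by rewrite /node mulrC divfK// pnatr_eq0 -lt0n.
  rewrite sumEFin lee_fin sumrMnr ler_wpMn2l ?(ltW d0)// big_split/= size_flatten.
  rewrite sumnE /shape -map_comp big_map leq_add2l.
  by rewrite big_const_seq count_predT iter_addn_0.
move=> S cS So.
apply: le_trans (leeD2r _ (total_length_ge S uF)).
have -> : delta *+ size F = \sum_(e <- F) delta.
  by rewrite big_const_seq count_predT iter_addr_0.
rewrite -sumEFin -big_split/= count_flatten -map_comp sumnE big_map -sumrMnr -sumEFin.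
apply: lee_sum => e _; have [mT Td Tg] := trace_shape e cS So.
apply: le_trans (grid_count_le mT Td Tg d0 M); rewrite lee_fin ler_wpMn2l ?(ltW d0)//.
rewrite /= count_map count_filter count_iota; apply: leq_sum => k _ /=.
have [tk|ntk] := pselect (tb e k); last by rewrite (asboolF ntk) andbF.
rewrite (asboolT tk) andbT.
have [Sk|nSk] := pselect (S (loc e k)); last by rewrite asboolF.
by rewrite [in leqRHS]asboolT ?leq_b1//; exact/locP.
Qed.

End Sampling.

Local Open Scope ereal_scope.

(** * The lower bound on the randomized ratio *)

Section LowerBound.
Variables (R : realType) (Q : network R).
Implicit Types (S : search Q) (H : location Q) (pts : seq (location Q)).
Local Notation mu := (@lebesgue_measure R).
Local Notation ball r := (walk_ball (origin Q) r).

Lemma search_time_ge0 S H : 0 <= search_time S H.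
Proof. by apply: le_ereal_inf_tmp => _ [t [t0 _ _] <-]; rewrite lee_fin. Qed.

Lemma explored_origin S t : (0 <= t)%R -> t%:E <= network_length Q ->
  S t (origin Q).
Proof.
by move=> t0 tQ; apply: (explored_mono (lexx 0%R) t0 tQ); rewrite explored0.
Qed.

Lemma search_time_lt S H c : search_time S H < c ->
  exists t : R, [/\ (0 <= t)%R, t%:E <= network_length Q, t%:E < c & S t H].
Proof. by move=> /ereal_inf_lt[_ [t [t0 tQ St] <-] tc]; exists t. Qed.

(** Explored sets increase, so finitely many points found before time c are all
    explored at a common time before c. *)
Lemma all_found S pts (c : R) : (0 < c)%R ->
  (forall H, H \in pts -> search_time S H < c%:E) ->
  exists t : R, [/\ (0 <= t)%R, t%:E <= network_length Q, (t < c)%R &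
                    forall H, H \in pts -> S t H].
Proof.
move=> c0; elim: pts => [_|H pts IH h].
  by exists 0%R; split=> //; apply/ltW; exact: network_length_gt0.
have [H' Hp|t [t0 tQ tc tP]] := IH; first by apply: h; rewrite inE Hp orbT.
have [u [u0 uQ uc uP]] := search_time_lt (h H (mem_head _ _)).
have [tu|ut] := leP t u; [exists u|exists t]; split=> // H'; rewrite inE.
  by move=> /predU1P[->//|/tP]; exact: explored_mono.
by move=> /predU1P[->|/tP//]; apply: explored_mono uP => //; exact: ltW.
Qed.

(** Among k points of the list, one is found no earlier than k delta - eps, since
    otherwise all k would be explored too soon.  Removing that point and
    iterating gives the sum of k delta - eps for k up to the size of the list. *)
Lemma sum_search_time_ge S (delta eps : R) pts : (0 < delta)%R ->
  (forall t : R, (0 <= t)%R -> t%:E <= network_length Q ->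
     (delta *+ count (fun H => `[< S t H >]) pts <= t + eps)%R) ->
  ((delta * (size pts * (size pts).+1)%:R / 2 - eps *+ size pts)%R)%:E <=
    \sum_(H <- pts) search_time S H.
Proof.
move=> d0; have [n] := ubnP (size pts); elim: n pts => // n IH pts szn hp.
have [->|pts0] := eqVneq pts [::].
  by rewrite big_nil /= mul0n mulr0 mul0r mulr0n subr0.
have [H Hp TH] : exists2 H, H \in pts &
    (delta *+ size pts - eps)%:E <= search_time S H.
  apply: contrapT => nex.
  have hlt H : H \in pts -> search_time S H < (delta *+ size pts - eps)%:E.
    by move=> Hp; rewrite ltNge; apply/negP => h; apply: nex; exists H.
  have c0 : (0 < delta *+ size pts - eps)%R.
    case: pts pts0 hlt {hp szn nex} => // H pts _ /(_ H (mem_head _ _)).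
    by move=> /(le_lt_trans (search_time_ge0 _ _)); rewrite lte_fin.
  have [t [t0 tQ tc tP]] := all_found c0 hlt.
  have := hp t t0 tQ; rewrite (_ : count _ pts = size pts).
    by move: tc; rewrite ltrBrDr => /lt_le_trans h /h; rewrite ltxx.
  by apply/eqP; rewrite -all_count; apply/allP => H' /tP ?; apply/asboolP.
have pr := perm_to_rem Hp; have sz := size_rem Hp.
have szE : size pts = (size (rem H pts)).+1.
  by rewrite sz prednK//; case: (pts) pts0.
rewrite (perm_big _ pr)/= big_cons.
have hrem (t : R) : (0 <= t)%R -> t%:E <= network_length Q ->
    (delta *+ count (fun H => `[< S t H >]) (rem H pts) <= t + eps)%R.
  move=> t0 tQ; apply: le_trans (hp t t0 tQ).
  rewrite ler_wpMn2l ?(ltW d0)//.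
  by apply: leq_count_subseq; exact: rem_subseq.
have szr : (size (rem H pts) < n)%N by rewrite -ltnS -szE.
apply: le_trans (leeD TH (IH _ szr hrem)).
rewrite -EFinD lee_fin szE; set k := size _.
rewrite -(mulr_natr delta) -!(mulr_natr eps) !natrM -[k.+2%:R]natr1 -[k.+1%:R]natr1; lra.
Qed.

(** Search times generate the sigma-algebra of the space of searches. *)
Lemma measurable_normalized_time (S0 : search Q) H : measurable_fun
  [set: g_sigma_algebraType (@search_events R Q S0)]
  (fun S => normalized_time S H : \bar R).
Proof.
rewrite /normalized_time; case: eqP => _; first exact: measurable_cst.
under eq_fun do rewrite muleC.
apply: measurable_funeM => _ Y mY; rewrite setTI.
apply: sub_sigma_algebra; exists H => //; exists Y => //.
by rewrite setTI.
Qed.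

Lemma normalized_time_ge0 S H : 0 <= normalized_time S H.
Proof.
rewrite /normalized_time; case: ifP => // _.
rewrite mule_ge0 ?search_time_ge0// lee_fin invr_ge0.
by apply: dist_ge => l /walk_ge0.
Qed.

Lemma search_time_normalized S H r : (0 < dist (origin Q) H < r)%R ->
  search_time S H <= r%:E * normalized_time S H.
Proof.
move=> /andP[d0 dr]; rewrite /normalized_time; case: eqP => [Ho|_].
  suff : (dist (origin Q) H <= 0)%R by rewrite leNgt d0.
  by rewrite Ho; apply: dist_le; exact: walk_nil.
rewrite muleCA -EFinM -[leLHS]mule1 lee_wpmul2l ?search_time_ge0//.
by rewrite lee_fin ler_pdivlMr// mul1r ltW.
Qed.

Section Randomized.
Variable s : randomized_search Q.

(** The bound of [sum_search_time_ge] holds for each search, hence in expectation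
    under the law of s; q bounds the expectation of each normalized time.  The
    errors due to the spacing c / M vanish as M grows. *)
Lemma ball_length_le (q r : R) : (0 < r)%R ->
  (forall H, expected_time s H <= q%:E) ->
  total_length (ball r) <= (2 * r * q)%:E.
Proof.
move=> r0 hq; have q0 : (0 <= q)%R.
  rewrite -lee_fin; apply: le_trans (hq (origin Q)).
  by apply: integral_ge0 => S _; exact: normalized_time_ge0.
apply: total_length_le => F uF.
have [c c0 hM] := sample_points uF r0.
suff h M : (0 < M)%N -> \sum_(e <- F) mu (trace (ball r) e) <=
    (2 * r * q + 4 * (size F)%:R * c / M%:R)%:E.
  apply/lee_addgt0Pr => eps eps0.
  have [M _ Mh] : exists2 M : nat, True & (4 * (size F)%:R * c / eps < M%:R)%R.
    by exists (Num.truncn (4 * (size F)%:R * c / eps)).+1 => //; exact: truncnS_gt.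
  have h0 : (0 <= 4 * (size F)%:R * c / eps)%R.
    apply: divr_ge0 (ltW eps0); apply: mulr_ge0 (ltW c0).
    by rewrite mulr_ge0 ?ler0n.
  have M0 : (0 < M)%N by rewrite -(ltr_nat R); exact: le_lt_trans Mh.
  apply: le_trans (h M M0) _; rewrite -EFinD lee_fin lerD2l.
  by rewrite ler_pdivrMr ?ltr0n// [leRHS]mulrC -ler_pdivrMr// ltW.
move=> M0; have [pts [ptsd ptsL ptsS]] := hM M M0.
set delta := (c / M%:R)%R in ptsL ptsS *.
have d0 : (0 < delta)%R by rewrite divr_gt0// ltr0n.
apply: (le_trans ptsL); rewrite lee_fin.
set n := size pts in ptsL *; set f := size F in ptsL ptsS *.
suff : (delta * n%:R / 2 - delta * f%:R <= r * q)%R.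
  rewrite -(mulr_natr delta) natrD natrM -(mulrA _ c) -/delta; lra.
have [->|n0] := eqVneq n 0%N.
  have := mulr_ge0 (ltW r0) q0; have := mulr_ge0 (ltW d0) (ler0n R f).
  rewrite mulr0 mul0r; lra.
have nR : (0 < n%:R :> R)%R by rewrite ltr0n lt0n.
have key S : (delta * (n * n.+1)%:R / 2 - delta *+ f *+ n)%R%:E <=
    r%:E * \sum_(H <- pts) normalized_time S H.
  apply: (@le_trans _ _ (\sum_(H <- pts) search_time S H)); last first.
    rewrite ge0_sume_distrr => [|H _]; last exact: normalized_time_ge0.
    rewrite big_seq_cond [leRHS]big_seq_cond; apply: lee_sum => H /andP[Hp _].
    exact/search_time_normalized/ptsd.
  apply: sum_search_time_ge => // t t0 tQ.
  rewrite -lee_fin EFinD -(explored_length S t0 tQ); apply: ptsS.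
    exact: explored_connected.
  exact: explored_origin.
have : (delta * (n * n.+1)%:R / 2 - delta *+ f *+ n <= r * (q *+ n))%R.
  set X := (X in (X <= _)%R) in key *.
  have [X0|/ltW X0] := leP 0%R X; last first.
    by apply: (le_trans X0); rewrite mulr_ge0 ?mulrn_wge0// ltW.
  rewrite -lee_fin.
  have -> : X%:E = \int[search_law s]_S cst X%:E S.
    rewrite integral_cst// [X in _ * X](_ : _ = 1) ?mule1//.
    exact: (probability_setT (search_law s)).
  apply: (@le_trans _ _ (\int[search_law s]_S
      (r%:E * \sum_(H <- pts) normalized_time S H))).
    apply: ge0_le_integral => //.
    apply: measurable_funeM; apply: emeasurable_sum => H.
    exact: measurable_normalized_time.
  rewrite ge0_integralZl//; first last.
  - by rewrite lee_fin ltW.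
  - by move=> S _; apply: sume_ge0 => H _; exact: normalized_time_ge0.
  - by apply: emeasurable_sum => H; exact: measurable_normalized_time.
  rewrite ge0_integral_sum//; first last.
  - by move=> H S _; exact: normalized_time_ge0.
  - by move=> H; exact: measurable_normalized_time.
  rewrite EFinM lee_wpmul2l ?lee_fin ?(ltW r0)//.
  have -> : (q *+ n = \sum_(H <- pts) q)%R.
    by rewrite big_const_seq count_predT iter_addr_0.
  rewrite -sumEFin.
  by apply: lee_sum => H _; exact: hq.
rewrite -(mulr_natr (delta *+ f)) -(mulr_natr delta) -(mulr_natr q) natrM.
rewrite -[n.+1%:R]natr1.
move=> h; rewrite -(ler_pM2r nR) -(mulrA r); apply: le_trans h.
rewrite -subr_ge0 (_ : _ - _ = delta * n%:R / 2)%R; last by field.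
by rewrite divr_ge0// mulr_ge0 ?ltW.
Qed.

End Randomized.

Lemma randomized_ratio_ge0 : 0 <= randomized_ratio Q.
Proof.
apply: le_ereal_inf_tmp => _ [s _ <-].
apply: le_ereal_sup_tmp; exists (expected_time s (origin Q)).
  by exists (origin Q).
by apply: integral_ge0 => S _; exact: normalized_time_ge0.
Qed.

Lemma ball_length_le_ratio (q r : R) : (0 < r)%R -> randomized_ratio Q = q%:E ->
  total_length (ball r) <= (2 * r * q)%:E.
Proof.
move=> r0 hq; apply/lee_addgt0Pr => eps eps0.
have q0 : randomized_ratio Q < (q + eps / (2 * r))%:E.
  by rewrite hq lte_fin ltrDl divr_gt0// mulr_gt0.
have [_ [s _ <-] sq] := ereal_inf_lt q0.
rewrite -EFinD (_ : _ + eps = 2 * r * (q + eps / (2 * r)))%R; last first.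
  by rewrite mulrDr mulrCA divff ?mulr1// mulf_neq0// gt_eqF.
apply: (@ball_length_le s) => // H; apply: ltW; apply: le_lt_trans sq.
by apply: ereal_sup_ubound; exists H.
Qed.

End LowerBound.

(** * The length of a ball as a function of its radius *)

Section Continuity.
Variables (R : realType) (Q : network R).
Implicit Types (e : arc Q) (F : seq (arc Q)) (A B : set (location Q)).
Local Notation mu := (@lebesgue_measure R).
Local Notation ball r := (walk_ball (origin Q) r).

Lemma trace_bigcup (A : nat -> set (location Q)) e :
  trace (\bigcup_n A n) e = \bigcup_n trace (A n) e.
Proof.
apply/seteqP; split=> [a [a0 al [x [n _ Ax] ex]]|a [n _ [a0 al [x Ax ex]]]].
  by exists n => //; split=> //; exists x.
by split=> //; exists x => //; exists n.
Qed.

Lemma sum_trace_bigcup_cvg (A : nat -> set (location Q)) F :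
  (forall n e, measurable (trace (A n) e)) ->
  (forall m n, (m <= n)%N -> A m `<=` A n) ->
  \sum_(e <- F) mu (trace (A n) e) @[n --> \oo] -->
    \sum_(e <- F) mu (trace (\bigcup_n A n) e).
Proof.
move=> mA homA; apply: cvg_nnesum => e _; first exact: nearW.
rewrite trace_bigcup; apply: nondecreasing_cvg_mu.
- by move=> n; exact: mA.
- by apply: bigcup_measurable => n _; exact: mA.
by move=> m n mn; apply/subsetPset; apply: traceS; exact: homA.
Qed.

Lemma total_length_bigcup (A : nat -> set (location Q)) c :
  (forall n e, measurable (trace (A n) e)) ->
  (forall m n, (m <= n)%N -> A m `<=` A n) ->
  (forall n, total_length (A n) <= c) -> total_length (\bigcup_n A n) <= c.
Proof.
move=> mA homA hc; apply: total_length_le => F uF.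
have cv := sum_trace_bigcup_cvg (F := F) mA homA; apply: (cvge_to_le cv).
by apply: nearW => n; apply: le_trans (hc n); exact: total_length_ge.
Qed.

Lemma le_total_length A B :
  (forall e, measurable (trace A e)) -> (forall e, measurable (trace B e)) ->
  A `<=` B -> total_length A <= total_length B.
Proof.
move=> mA mB AB; apply: le_esum => e _.
by apply: le_measure; rewrite ?inE; [exact: mA|exact: mB|exact: traceS].
Qed.

(** Outside of F, the set A has no more length than B.  The inequality is stated
    with sums on both sides because the lengths may be infinite. *)
Lemma total_length_tail A B F : uniq F ->
  (forall e, measurable (trace A e)) -> (forall e, measurable (trace B e)) ->
  A `<=` B ->
  total_length A + \sum_(e <- F) mu (trace B e) <=
    \sum_(e <- F) mu (trace A e) + total_length B.
Proof.
move=> uF mA mB AB.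
have split C : total_length C = \sum_(e <- F) mu (trace C e) +
    \esum_(e in ~` [set` F]) mu (trace C e).
  rewrite /total_length (esumID [set` F])// setTI setTI esum_fset//.
  by rewrite (fsbig_seq _ _ uF).
rewrite (split A) (split B) -addeA; apply: leeD2l; rewrite addeC; apply: leeD2l.
apply: le_esum => e _.
by apply: le_measure; rewrite ?inE; [exact: mA|exact: mB|exact: traceS].
Qed.

Lemma ball_origin r : (0 < r)%R -> ball r (origin Q).
Proof. by exists 0%R => //; exact: walk_nil. Qed.

Lemma ball_nil r : (r <= 0)%R -> ball r = set0.
Proof.
move=> r0; apply/seteqP; split=> // x [l wl lr].
by have := le_lt_trans (walk_ge0 wl) (lt_le_trans lr r0); rewrite ltxx.
Qed.

Lemma subset_ball r r' : (r <= r')%R -> ball r `<=` ball r'.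
Proof. by move=> rr x [l wl lr]; exists l => //; exact: lt_le_trans rr. Qed.

Lemma trace_set0 e : trace set0 e = set0.
Proof. by apply/seteqP; split=> // a [_ _ []]. Qed.

Lemma measurable_trace_ball r e : measurable (trace (ball r) e).
Proof.
have [r0|r0] := ltP 0%R r; last by rewrite ball_nil// trace_set0.
by apply: trace_measurable (@walk_ball_connected _ _ _ r) (ball_origin r0).
Qed.

Lemma le_ball_length r r' : (r <= r')%R ->
  total_length (ball r) <= total_length (ball r').
Proof.
move=> rr; apply: le_total_length => *; last exact: subset_ball.
  exact: measurable_trace_ball.
exact: measurable_trace_ball.
Qed.

Lemma finite_trace_sphere e r : bounded_spheres Q -> (0 < r)%R ->
  finite_set (trace [set x | dist (origin Q) x = r] e).
Proof.
move=> [N hN] r0.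
have fS : finite_set [set x | dist (origin Q) x = r].
  by apply: card_le_finite (hN r r0) _; exact: finite_II.
apply: sub_finite_set (finite_image
  (fun x => if x is Inside _ a _ _ then a else 0%R) fS).
move=> a [a0 al [x xr ex]]; exists x => //.
by have [h [h' ->]] := on_arc_inside a0 al ex.
Qed.

(** On a given arc, the balls of radius r + 1/n decrease to a set that exceeds the
    ball of radius r by a part of the sphere, which is null; the arcs outside of
    a suitable finite F contribute at most eps, uniformly in n. *)
Lemma ball_length_right_cont r (t : R) : bounded_spheres Q -> (0 < r)%R ->
  total_length (ball (r + 1)) < +oo ->
  (forall n : nat, t%:E <= total_length (ball (r + n.+1%:R^-1))) ->
  t%:E <= total_length (ball r).
Proof.
move=> bQ r0 fin1 ht; apply/lee_addgt0Pr => eps eps0.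
pose B n := ball (r + n.+1%:R^-1).
have mB n e : measurable (trace (B n) e) by exact: measurable_trace_ball.
have homB m n : (m <= n)%N -> B n `<=` B m.
  move=> mn; apply: subset_ball; rewrite lerD2l lef_pV2 ?posrE ?ltr0n//.
  by rewrite ler_nat.
have B0 : B 0%N = ball (r + 1) by rewrite /B invr1.
have fB : total_length (B 0%N) \is a fin_num.
  by rewrite B0 ge0_fin_numE//; exact: esum_ge0.
(* finitely many arcs carry all but eps of the length of the larger ball *)
have [F uF hF] : exists2 F : seq (arc Q), uniq F &
    total_length (B 0%N) <= \sum_(e <- F) mu (trace (B 0%N) e) + eps%:E.
  have [_ [X [fX _] <-] hX] := ub_ereal_sup_adherent eps0 fB.
  exists (finmap.enum_fset (fset_set X)); first exact: finmap.fset_uniq.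
  by rewrite -(fsbig_finite _ _ fX) -leeBlDr// ltW.
have fF : \sum_(e <- F) mu (trace (B 0%N) e) \is a fin_num.
  rewrite ge0_fin_numE; last exact: sume_ge0.
  by apply: le_lt_trans (total_length_ge _ uF) _; rewrite B0.
have tB n : t%:E <= \sum_(e <- F) mu (trace (B n) e) + eps%:E.
  have := total_length_tail uF (mB n) (mB 0%N) (homB _ _ (leq0n n)).
  move=> /le_trans/(_ (leeD2l _ hF)); rewrite addeCA [X in _ <= X]addeC leeD2rE//.
  move=> h; apply: (le_trans (ht n)); apply: (le_trans h).
  by rewrite lexx.
have cv : \sum_(e <- F) mu (trace (B n) e) @[n --> \oo] -->
    \sum_(e <- F) mu (\bigcap_n trace (B n) e).
  apply: cvg_nnesum => e _; first exact: nearW.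
  apply: nonincreasing_cvg_mu.
  - rewrite -B0 in fin1; apply: le_lt_trans fin1.
    by have := total_length_ge (B 0%N) (s := [:: e]) isT; rewrite big_seq1.
  - by move=> n; exact: mB.
  - by apply: bigcap_measurableType => n _; exact: mB.
  - by move=> m n mn; apply/subsetPset; apply: traceS; exact: homB.
have h1 : t%:E - eps%:E <= \sum_(e <- F) mu (\bigcap_n trace (B n) e).
  by apply: (cvge_to_ge cv); apply: nearW => n; rewrite leeBlDr.
rewrite -leeBlDr//; apply: (le_trans h1).
apply: le_trans (total_length_ge _ uF); apply: lee_sum => e _.
pose Sph := trace [set x | dist (origin Q) x = r] e.
have /finite_set_countable cS : finite_set Sph by exact: finite_trace_sphere.
have S0 : mu Sph = 0 by exact: countable_lebesgue_measure0.
have mS : measurable Sph by exact: countable_measurable.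
rewrite -[leRHS]adde0 -S0; apply: le_trans (measureU2 _ _ _) => //; last first.
  exact: measurable_trace_ball.
apply: le_measure; rewrite ?inE.
- by apply: bigcap_measurableType => n _; exact: mB.
- by apply: measurableU => //; exact: measurable_trace_ball.
move=> a ha; have [a0 al _] := ha 0%N I.
have {}ha n : (dist (origin Q) (Inside a0 al) < r + n.+1%:R^-1)%R.
  apply/walk_ball_dist; first exact: network_connected.
  by apply/(traceP _ a0 al); exact: ha.
have : (dist (origin Q) (Inside a0 al) <= r)%R.
  rewrite leNgt; apply/negP => /ltr_add_invr[k hk].
  by have := lt_trans hk (ha k); rewrite ltxx.
rewrite le_eqVlt => /predU1P[h|h]; [right|left]; apply/(traceP _ a0 al) => //.
by apply/walk_ball_dist => //; exact: network_connected.
Qed.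

End Continuity.

(** * Breadth-first search *)

Section BreadthFirst.
Variables (R : realType) (Q : network R) (K : R).
Hypothesis bQ : bounded_spheres Q.
Hypothesis K_gt0 : (0 < K)%R.
Local Notation ball r := (walk_ball (origin Q) r).
Hypothesis ballK : forall r : R, (0 < r)%R -> total_length (ball r) <= (K * r)%:E.

Lemma total_length_ge0 (A : set (location Q)) : 0 <= total_length A.
Proof. exact: esum_ge0. Qed.

Lemma trace_add_origin (A : set (location Q)) e :
  trace (origin Q |` A) e = trace A e.
Proof.
apply/seteqP; split; last by apply: traceS => x; right.
move=> a [a0 al [x [->|Ax] ex]]; last by split=> //; exists x.
by have [h [h' ]] := on_arc_inside a0 al ex.
Qed.

Lemma total_length_add_origin (A : set (location Q)) :
  total_length (origin Q |` A) = total_length A.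
Proof. by apply: eq_esum => e _; congr lebesgue_measure; exact: trace_add_origin. Qed.

(** The balls are indexed by their length rather than by an inverse of the length
    function, so that no choice of a radius is needed.  The condition 0 < t makes
    the search start from the root alone. *)
Definition swept (t : R) : set (location Q) :=
  \bigcup_(r in [set r | (0 < t)%R /\ total_length (ball r) <= t%:E]) ball r.

Definition bfs (t : R) : set (location Q) := origin Q |` swept t.

(** The set explored at time t is an open ball, whose radius r is a threshold:
    balls of smaller radius have length at most t, balls of larger radius have
    length more than t.  Continuity of the length at r gives the value t. *)
Lemma swept_ball (t r : R) : (0 < t)%R -> (0 < r)%R ->
  (forall r', (r' < r)%R -> total_length (ball r') <= t%:E) ->
  (forall r', (r < r')%R -> t%:E < total_length (ball r')) ->
  total_length (swept t) = t%:E.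
Proof.
move=> t0 r0 hlt hgt.
have -> : swept t = ball r.
  apply/seteqP; split=> [x [r' [_ hr']]|x [l wl lr]].
    apply: subset_ball; rewrite leNgt; apply/negP => /hgt.
    by rewrite ltNge hr'.
  have [r' lr' r'r] : exists2 r', (l < r')%R & (r' < r)%R.
    by exists ((l + r) / 2)%R; rewrite ?midf_lt.
  by exists r'; [split=> //; exact: hlt|exists l].
apply/eqP; rewrite eq_le; apply/andP; split.
  have -> : ball r = \bigcup_n ball (r - n.+1%:R^-1).
    apply/seteqP; split=> [x [l wl lr]|x [n _]].
      have [k hk] := ltr_add_invr lr; exists k => //; exists l => //.
      by rewrite ltrBrDr.
    by apply: subset_ball; rewrite gerBl invr_ge0.
  apply: total_length_bigcup.
  - by move=> n e; exact: measurable_trace_ball.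
  - move=> m n mn; apply: subset_ball; rewrite lerD2l lerN2 lef_pV2 ?posrE//.
    by rewrite ler_nat.
  - by move=> n; apply: hlt; rewrite ltrBlDr ltrDl.
apply: ball_length_right_cont => //.
  by apply: le_lt_trans (ballK _) _; rewrite ?ltry// addr_gt0.
by move=> n; apply/ltW/hgt; rewrite ltrDl.
Qed.

Lemma swept_length (t : R) : (0 <= t)%R -> t%:E <= network_length Q ->
  total_length (swept t) = t%:E.
Proof.
rewrite le_eqVlt => /predU1P[<- _|t0 tQ].
  rewrite (_ : swept 0 = set0).
    apply: esum1 => e _.
    by rewrite -[RHS](@measure0 _ _ _ (@lebesgue_measure R)) -(trace_set0 e).
  by apply/seteqP; split=> // x [r [/=]]; rewrite ltxx.
pose X := [set r : R | total_length (ball r) <= t%:E].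
have X0 : X (t / K)%R.
  have h : (0 < t / K)%R by rewrite divr_gt0.
  by apply: le_trans (ballK h) _; rewrite mulrC divfK// gt_eqF.
(* if no radius exceeds the length t, the balls exhaust the network *)
have [ubX|nubX] := pselect (has_ubound X).
  have supX : has_sup X by split=> //; exists (t / K)%R.
  apply: (@swept_ball t (sup X)) => //.
  - by apply: lt_le_trans (ub_le_sup ubX X0); rewrite divr_gt0.
  - move=> r' /(sup_gt supX.1)[r'' Xr'' rr].
    by apply: le_trans Xr''; apply: le_ball_length; exact: ltW.
  - move=> r' hr'; rewrite ltNge; apply/negP => Xr'.
    by have := lt_le_trans hr' (ub_le_sup ubX Xr'); rewrite ltxx.
have bt r : total_length (ball r) <= t%:E.
  apply: contrapT => nr; apply: nubX; exists r => r' Xr'.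
  rewrite leNgt; apply/negP => /ltW rr'; apply: nr.
  by apply: le_trans Xr'; exact: le_ball_length.
have UT : \bigcup_n ball n%:R = [set: location Q].
  apply/seteqP; split=> // x _; have [l wl] := network_connected (origin Q) x.
  by exists (Num.truncn l).+1 => //; exists l => //; exact: truncnS_gt.
have -> : swept t = [set: location Q].
  by apply/seteqP; split=> // x _; have : [set: location Q] x by [];
    rewrite -UT => -[n _ xn]; exists n%:R.
apply/eqP; rewrite eq_le tQ andbT -UT; apply: total_length_bigcup => //.
- by move=> n e; exact: measurable_trace_ball.
- by move=> m n mn; apply: subset_ball; rewrite ler_nat.
Qed.

Lemma bfs0 : bfs 0 = [set origin Q].
Proof.
apply/seteqP; split=> [x [//|[r [/=]]]|x ->]; last by left.
by rewrite ltxx.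
Qed.

Lemma bfs_mono (t t' : R) : (0 <= t)%R -> (t <= t')%R ->
  t'%:E <= network_length Q -> bfs t `<=` bfs t'.
Proof.
move=> _ tt _ x [->|[r [t0 rt] rx]]; [by left|right; exists r => //].
split; first exact: lt_le_trans tt.
by apply: le_trans rt _; rewrite lee_fin.
Qed.

Lemma bfs_connected (t : R) : (0 <= t)%R -> t%:E <= network_length Q ->
  connected (bfs t).
Proof.
move=> _ _; have -> : bfs t = \bigcup_(A in [set A | A = [set origin Q] \/
    exists2 r, total_length (ball r) <= t%:E /\ (0 < t)%R & A = origin Q |` ball r]) A.
  apply/seteqP; split=> [x [->|[r [t0 rt] rx]]|x [A [->|[r [rt t0] ->]]]].
  - by exists [set origin Q] => //; left.
  - by exists (origin Q |` ball r); [right; exists r|right].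
  - by move=> ->; left.
  - by move=> [->|rx]; [left|right; exists r].
apply: bigcup_connected.
  by exists (origin Q) => A [->//|[r _ ->]]; left.
move=> A [->|[r _ ->]]; first exact: connected1.
have [r0|r0] := ltP 0%R r; last by rewrite ball_nil// setU0; exact: connected1.
rewrite (_ : _ |` _ = ball r); first exact: walk_ball_connected.
by apply/setUidPr => x ->; exact: ball_origin.
Qed.

Lemma bfs_length (t : R) : (0 <= t)%R -> t%:E <= network_length Q ->
  total_length (bfs t) = t%:E.
Proof. by move=> t0 tQ; rewrite total_length_add_origin swept_length. Qed.

Definition bfs_search : search Q :=
  Search bfs0 bfs_mono bfs_connected bfs_length.

(** A ball that contains H, of radius r close to the distance of H, is explored at
    the latest at time K r, or at the end of the search if this comes before. *)
Lemma bfs_time H : search_time bfs_search H <= (K * dist (origin Q) H)%:E.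
Proof.
apply/lee_addgt0Pr => eps eps0; set d := dist _ _.
have d0 : (0 <= d)%R by apply: dist_ge => l /walk_ge0.
pose r := (d + eps / K)%R.
have r0 : (0 < r)%R by rewrite ltr_wpDl// divr_gt0.
have Hr : ball r H.
  by apply/walk_ball_dist; [exact: network_connected|rewrite ltrDl divr_gt0].
have -> : (K * d)%:E + eps%:E = (K * r)%:E.
  by rewrite -EFinD mulrDr (mulrC K (eps / K)%R) divfK// gt_eqF.
have Kr0 : (0 < K * r)%R by rewrite mulr_gt0.
have [t [t0 tQ tK rt]] : exists t : R, [/\ (0 < t)%R, t%:E <= network_length Q,
    (t <= K * r)%R & total_length (ball r) <= t%:E].
  have rQ : total_length (ball r) <= network_length Q.
    rewrite /network_length; apply: le_total_length => // e.
      exact: measurable_trace_ball.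
    rewrite (_ : trace _ e = [set a : R | (0 < a)%R /\ a%:E < arc_length e]).
      apply: is_interval_measurable => a b [a0 _] [_ bl] c /andP[ac cb]; split.
        exact: lt_le_trans ac.
      by apply: le_lt_trans bl; rewrite lee_fin.
    apply/seteqP; split=> [a []//|a [a0 al]]; split=> //.
    by exists (Inside a0 al).
  have [KQ|QK] := leP (K * r)%:E (network_length Q).
    by exists (K * r)%R; split=> //; exact: ballK.
  have fQ : network_length Q \is a fin_num.
    rewrite ge0_fin_numE; first by apply: lt_trans QK _; rewrite ltry.
    exact: total_length_ge0.
  exists (fine (network_length Q)); rewrite fineK//; split=> //.
    by rewrite -lte_fin fineK//; exact: network_length_gt0.
  by rewrite -lee_fin fineK// ltW.
apply: ge_ereal_inf; exists t%:E; last by rewrite lee_fin.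
exists t => //; split=> //; first exact: ltW.
by right; exists r.
Qed.

Lemma deterministic_ratio_le : deterministic_ratio Q <= K%:E.
Proof.
apply: ge_ereal_inf; exists (ereal_sup [set normalized_time bfs_search H |
    H in [set: location Q]]); first by exists bfs_search.
apply: ge_ereal_sup => _ [H _ <-]; rewrite /normalized_time.
case: eqP => [_|_]; first by rewrite lee_fin ltW.
have d0 : (0 <= dist (origin Q) H)%R by apply: dist_ge => l /walk_ge0.
have [d00|dn0] := eqVneq (dist (origin Q) H) 0%R.
  by rewrite d00 invr0 mule0 lee_fin ltW.
rewrite lee_pdivrMr ?lt_def ?dn0//; exact: bfs_time.
Qed.

End BreadthFirst.

(** * Comparison of the two ratios *)

Section FairCoin.
Context d (T : measurableType d) (R : realType) (a b : T).

Let half : {nonneg R} := (2^-1)%:nng%R.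

Definition fair_coin : set T -> \bar R :=
  measure_add (mscale half (\d_a)) (mscale half (\d_b)).

HB.instance Definition _ := Measure.on fair_coin.

Let fair_coinT : fair_coin setT = 1.
Proof.
have hT c : mscale half (\d_c) [set: T] = (2^-1)%:E.
  by rewrite /mscale /= diracT mule1.
rewrite /fair_coin measure_addE.
transitivity ((2^-1)%:E + (2^-1)%:E : \bar R); first by congr (_ + _); exact: hT.
rewrite -EFinD.
by congr EFin; lra.
Qed.

HB.instance Definition _ :=
  Measure_isProbability.Build _ _ _ fair_coin fair_coinT.

Lemma integral_fair_coin (f : T -> \bar R) :
  measurable_fun setT f -> (forall x, 0 <= f x) ->
  \int[fair_coin]_x f x = (2^-1)%:E * (f a + f b).
Proof.
move=> mf f0; rewrite ge0_integral_measure_add// !ge0_integral_mscale//.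
by rewrite !integral_dirac// !diracT !mul1e ge0_muleDr.
Qed.

End FairCoin.

(** A fair coin decides between two searches.  With S1 = S2 this is the
    deterministic search S1. *)
Section TwoSearches.
Variables (R : realType) (Q : network R).

Definition coin_search (S1 S2 : search Q) : randomized_search Q :=
  @RandomizedSearch R Q S1
    (@fair_coin _ (g_sigma_algebraType (@search_events R Q S1)) R S1 S2).

Lemma expected_coin_search S1 S2 H :
  expected_time (coin_search S1 S2) H =
    (2^-1)%:E * (normalized_time S1 H + normalized_time S2 H).
Proof.
rewrite /expected_time integral_fair_coin//.
  exact: measurable_normalized_time.
by move=> S; exact: normalized_time_ge0.
Qed.

Lemma randomized_ratio_le_deterministic :
  randomized_ratio Q <= deterministic_ratio Q.
Proof.
apply: le_ereal_inf_tmp => _ [S _ <-]; apply: ge_ereal_inf.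
exists (ereal_sup [set expected_time (coin_search S S) H | H in [set: location Q]]).
  by exists (coin_search S S).
apply: ge_ereal_sup => _ [H _ <-]; rewrite expected_coin_search.
rewrite -mule2n -[_ *+ 2]mule_natl muleA -EFinM mulVf// mul1e.
by apply: ereal_sup_ubound; exists H.
Qed.

Lemma half_deterministic_le_randomized : bounded_spheres Q ->
  (2^-1)%:E * deterministic_ratio Q <= randomized_ratio Q.
Proof.
move=> bQ; have := randomized_ratio_ge0 Q.
case E : (randomized_ratio Q) => [q| |] // q0; last by rewrite leey.
suff : deterministic_ratio Q <= (2 * q)%:E.
  have half0 : 0 <= (2^-1)%:E :> \bar R by rewrite lee_fin.
  move=> /(lee_wpmul2l half0) h; apply: (le_trans h).
  by rewrite -EFinM mulKf.
apply/lee_addgt0Pr => eps eps0; rewrite -EFinD.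
rewrite lee_fin in q0.
apply: deterministic_ratio_le => // [|r r0].
  by rewrite ltr_wpDl// mulr_ge0.
apply: le_trans (ball_length_le_ratio r0 E) _.
by rewrite lee_fin (mulrAC _ r) ler_wpM2r ?(ltW r0)// lerDl ltW.
Qed.

End TwoSearches.

Local Open Scope ring_scope.

(** * The broom: a handle with many short bristles *)

Section Broom.
Variables (R : realType) (n : nat) (eps : R) (eps_gt0 : 0 < eps).

(** [None] is the handle, [Some i] the i-th bristle; the vertex [Some e] is the
    far end of the arc e, the vertex [None] is the root. *)
Let broom_arc : choiceType := option 'I_n.
Let broom_vertex : choiceType := option broom_arc.

Definition broom_len (e : broom_arc) : R := if e is Some _ then eps else 1.
Definition broom_src (e : broom_arc) : broom_vertex :=
  if e is Some _ then Some None else None.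

Lemma broom_len_gt0 e : 0 < broom_len e.
Proof. by case: e => [i|] /=. Qed.

Lemma broom_arc_length_gt0 (e : broom_arc) : (0 < (broom_len e)%:E)%E.
Proof. by rewrite lte_fin broom_len_gt0. Qed.

Lemma broom_tgt_unbounded (e : broom_arc) :
  Some (Some e) = None <-> (broom_len e)%:E = +oo%E.
Proof. by []. Qed.

Definition broom_graph : metric_graph R :=
  @MetricGraph R broom_vertex broom_arc (fun e => (broom_len e)%:E) broom_src
    (fun e => Some (Some e)) broom_arc_length_gt0 broom_tgt_unbounded.

Let O : location broom_graph := AtVertex (None : vertex broom_graph).

Section Offset.
(* two functions on the broom have the following form: the distance from the
   root, and the time at which a point is found when the bristles are searched
   one after the other; they only differ by the value h e at the start of e *)
Variable h : broom_arc -> R.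
Hypothesis h0 : h None = 0.
Hypothesis h1 : forall i, 1 <= h (Some i).

Definition height (x : location broom_graph) : R :=
  match x with
  | AtVertex None => 0
  | AtVertex (Some e) => h e + broom_len e
  | Inside e a _ _ => h e + a
  end.

(** Equality fails at the hub, seen as the start of a bristle: its height is
    taken from the handle. *)
Lemma height_le e a x : @on_arc R broom_graph e a x -> height x <= h e + a.
Proof.
case: x => [v|e' a' ? ?] /=; last by move=> [-> ->].
move=> [[-> <-]|[[->] [<-]]]//=; rewrite addr0.
by case: e => [i|] /=; rewrite h0 ?add0r.
Qed.

Lemma height_arc x : exists e a, [/\ @on_arc R broom_graph e a x,
  height x = h e + a, 0 <= a & a <= broom_len e].
Proof.
case: x => [[e|]|e a p q].
- by exists e, (broom_len e); split=> //; [right|exact: ltW (broom_len_gt0 e)].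
- by exists None, 0; split=> //=; [left|rewrite h0 addr0].
by exists e, a; split=> //; exact: ltW.
Qed.

Lemma height_gt0 x : x <> O -> 0 < height x.
Proof.
have hge0 e : 0 <= h e by case: e => [i|]; rewrite ?h0//; apply: le_trans (h1 i).
by case: x => [[e|]//|e a p q] _ /=; rewrite ltr_wpDl// broom_len_gt0.
Qed.

Lemma height_ge0 x : 0 <= height x.
Proof.
have [->//|/height_gt0/ltW//] := pselect (x = O).
Qed.

Definition sweep (t : R) : set (location broom_graph) := [set x | height x <= t].

(** A point of the sweep is joined to the root by the handle and by the part of
    its bristle below it. *)
Lemma sweep_connected t : 0 <= t -> connected (sweep t).
Proof.
move=> t0.
pose seg e a :=
  [set x | exists2 c, 0 <= c <= a & @on_arc R broom_graph e c x].
have cseg e a : a <= broom_len e -> connected (seg e a).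
  by move=> al; apply: connected_arc_segment => //; rewrite lee_fin.
have -> : sweep t = \bigcup_(C in [set C | [/\ connected C, C O & C `<=` sweep t]]) C.
  apply/seteqP; split=> [x xt|x [C [_ _ Ct] /Ct]//].
  have [e [a [ex hx a0 al]]] := height_arc x.
  have sub e' b : h e' + b <= t -> seg e' b `<=` sweep t.
    move=> hb y [c /andP[_ cb] /height_le hy]; apply: le_trans hy _.
    by apply: le_trans hb; rewrite lerD2l.
  have Oseg b : 0 <= b -> seg None b O by move=> b0; exists 0; [rewrite lexx|left].
  rewrite /sweep/= hx in xt; case: e ex hx al xt => [i|] ex hx al xt.
    exists (seg None 1 `|` seg (Some i) a); last by right; exists a; rewrite ?a0/=.
    split; [|by left; apply: Oseg|].
    - have hub : seg None 1 (AtVertex (Some None : vertex broom_graph)).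
        by exists 1; [rewrite ler01 lexx|right].
      apply: connectedU; [|exact: cseg|exact: cseg].
      exists (AtVertex (Some None : vertex broom_graph)); split=> //.
      by exists 0; [rewrite lexx a0|left].
    - move=> y [|]; apply: sub => //.
      rewrite h0 add0r; apply: le_trans xt; apply: le_trans (h1 i) _.
      by rewrite lerDl.
  exists (seg None a); last by exists a; rewrite ?a0/=.
  by split; [exact: cseg|exact: Oseg|exact: sub].
by apply: bigcup_connected => [|C []//]; exists O => C [].
Qed.

Lemma broom_total_length (A : set (location broom_graph)) :
  total_length A =
    (\sum_(e : option 'I_n) lebesgue_measure (trace A (e : arc broom_graph)))%E.
Proof.
apply/eqP; rewrite eq_le; apply/andP; split; last first.
  apply: (@total_length_ge R broom_graph A (index_enum (option 'I_n))).
  exact: index_enum_uniq.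
apply: total_length_le => s us; rewrite (@big_uniq _ _ _ (option 'I_n) s)//.
by rewrite big_mkcond/=; apply: lee_sum => e _; case: ifP.
Qed.

(** How much of an arc of length l is covered when its search started u earlier;
    u is negative before that time. *)
Definition clamp (l u : R) : R := Num.max 0 (Num.min l u).

Lemma sweep_trace t e :
  lebesgue_measure (trace (sweep t) e) = (clamp (broom_len e) (t - h e))%:E.
Proof.
have l0 := broom_len_gt0 e.
have tE : trace (sweep t) e = [set a | [/\ 0 < a, a < broom_len e & h e + a <= t]].
  apply/seteqP; split=> a.
    by move=> ta; have [a0 al _] := ta; move: ta => /(traceP _ a0 al).
  by move=> [a0 al ha]; apply/(@traceP _ _ _ e a a0 al).
rewrite tE /clamp; set u := t - h e.
have [ul|lu] := ltP u (broom_len e).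
  have -> : [set a | [/\ 0 < a, a < broom_len e & h e + a <= t]] = `]0, u]%classic.
    apply/seteqP; split=> a /=; rewrite in_itv/=.
      by move=> [-> _ ha]; rewrite /u; lra.
    by move=> /andP[-> au]; split=> //; move: au ul; rewrite /u; lra.
  rewrite lebesgue_measure_itv/= lte_fin.
  by case: (ltP 0 u) => u0; rewrite ?oppr0 ?adde0.
have -> : [set a | [/\ 0 < a, a < broom_len e & h e + a <= t]] =
    `]0, broom_len e[%classic.
  apply/seteqP; split=> a /=; rewrite in_itv/=; first by move=> [-> ->].
  by move=> /andP[-> al]; split=> //; move: al lu; rewrite /u; lra.
rewrite lebesgue_measure_itv/= lte_fin l0 oppr0 adde0.
by rewrite (max_idPr (ltW l0)).
Qed.

End Offset.

(** Bristles searched one after the other are covered like a single segment. *)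
Lemma sum_clamp (u : R) m :
  \sum_(j < m) clamp eps (u - j%:R * eps) = clamp (m%:R * eps) u.
Proof.
elim: m => [|m IH].
  by rewrite big_ord0 mul0r /clamp; apply/esym/max_idPl; rewrite ge_min lexx.
rewrite big_ord_recr/= {}IH /clamp -[m.+1%:R]natr1 mulrDl mul1r.
have : 0 <= m%:R * eps by rewrite mulr_ge0// ltW.
set N := m%:R * eps => N0.
have [a|a] := leP N u; have [b|b] := leP eps (u - N); have [c|c] := leP (N + eps) u;
  rewrite /Num.max; repeat case: ifP => [?|/negbT]; rewrite -?leNgt;
  by have := eps_gt0; move=> *; lra.
Qed.

Section Order.
Variable p : 'I_n -> 'I_n.
Hypothesis p_inj : injective p.

(** The search time at the start of e, when p gives the rank of each bristle. *)
Definition start (e : broom_arc) : R :=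
  if e is Some i then 1 + (p i)%:R * eps else 0.

Lemma start_ge1 i : 1 <= start (Some i).
Proof. by rewrite lerDl mulr_ge0// ltW. Qed.

Lemma sweep_length t : 0 <= t -> t <= 1 + n%:R * eps ->
  total_length (sweep start t) = t%:E.
Proof.
move=> t0 tn; rewrite broom_total_length.
under eq_bigr do rewrite sweep_trace; rewrite sumEFin; congr EFin.
rewrite (bigD1 None)//= subr0.
rewrite (reindex_omap Some id) => [|[]//]; rewrite /= big_mkcond/=.
under eq_bigr => i _ do rewrite eqxx opprD addrA.
rewrite (_ : \sum_i _ = \sum_(j < n) clamp eps (t - 1 - j%:R * eps)); last first.
  by rewrite [RHS](reindex_inj p_inj).
rewrite sum_clamp.
rewrite /clamp; have := mulr_ge0 (ler0n R n) (ltW eps_gt0) => N0.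
have [a|a] := leP t 1; have [b|b] := leP (n%:R * eps) (t - 1);
  rewrite /Num.max; repeat case: ifP => [?|/negbT]; rewrite -?leNgt;
  by move=> *; lra.
Qed.

End Order.

Let id_inj : injective (@id 'I_n). Proof. by []. Qed.

Definition base (e : broom_arc) : R := if e is Some _ then 1 else 0.

Definition depth := height base.

Lemma depth_arc e a x : @on_arc R broom_graph e a x ->
  depth x = base e + a.
Proof.
case: x => [v|e' a' ? ?] /=; last by move=> [-> ->].
move=> [[-> <-]|[[->] [<-]]]//=.
by rewrite addr0; case: e => [i|] /=; rewrite /depth/= ?add0r.
Qed.

Lemma depth_param x : exists e a, [/\ @on_arc R broom_graph e a x,
  depth x = base e + a, 0 <= a & a <= broom_len e].
Proof. exact: (@height_arc base erefl x). Qed.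

Lemma depth_lipschitz : arc_lipschitz depth.
Proof.
move=> e a b x y /depth_arc-> /depth_arc->.
by rewrite opprD addrACA subrr add0r.
Qed.

Lemma walk_depth x : walk O x (depth x).
Proof.
have [e [a [ex -> a0 al]]] := depth_param x.
case: e ex al => [i|] ex al; last first.
  rewrite add0r -[a](ger0_norm a0) -(normrN a) -(sub0r a) -[`|_|]addr0.
  by apply: walk_cons ex (walk_nil _); left.
have h1 : @on_arc R broom_graph None 0 O by left.
pose hub : location broom_graph := AtVertex (Some None : vertex broom_graph).
have h2 : @on_arc R broom_graph None 1 hub by right.
have h3 : @on_arc R broom_graph (Some i) 0 hub by left.
have := walk_cons h1 h2 (walk_cons h3 ex (walk_nil _)).
by rewrite !sub0r !normrN normr1 (ger0_norm a0) addr0.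
Qed.

Lemma broom_connected (x y : location broom_graph) : exists l, walk x y l.
Proof.
exists (depth x + depth y); apply: walk_cat (walk_depth y).
exact/walk_sym/walk_depth.
Qed.

Lemma start_height_le p x : height (start p) x <= 1 + n%:R * eps.
Proof.
have N0 : 0 <= n%:R * eps by rewrite mulr_ge0// ltW.
have [e [a [_ -> a0 al]]] := @height_arc (start p) erefl x.
case: e al => [i|] /= al; last by rewrite add0r (le_trans al)// lerDl.
rewrite -addrA lerD2l; apply: (@le_trans _ _ ((p i).+1%:R * eps)).
  by rewrite -[(p i).+1%:R]natr1 mulrDl mul1r lerD2l.
by rewrite ler_pM2r// ler_nat.
Qed.

Lemma broom_length : total_length [set: location broom_graph] = (1 + n%:R * eps)%:E.
Proof.
rewrite -(sweep_length id_inj) //; last by rewrite addr_ge0// mulr_ge0// ltW.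
congr total_length; apply/seteqP; split=> // x _; exact: start_height_le.
Qed.

Lemma broom_length_gt0 : (0 < total_length [set: location broom_graph])%E.
Proof.
rewrite broom_length lte_fin ltr_pwDl//; apply: mulr_ge0 => //; exact: ltW.
Qed.

Definition broom : network R :=
  @Network R broom_graph (None : broom_vertex) broom_connected broom_length_gt0.

Lemma broom_dist x : dist (origin broom) x = depth x.
Proof.
apply/eqP; rewrite eq_le; apply/andP; split.
  by apply: (@dist_le R broom); exact: walk_depth.
apply: (@dist_ge R broom) => l wl.
have := arc_lipschitz_walk depth_lipschitz wl.
by rewrite /depth/= sub0r normrN; apply: le_trans; exact: ler_norm.
Qed.

Lemma broom_bounded_spheres : bounded_spheres broom.
Proof.
have /finite_setP[N hN] : finite_set [set: option 'I_n] by exact: finite_finset.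
exists N => r r0.
apply: card_le_trans (_ : _ #<= [set: option 'I_n])%card _; last first.
  by move: hN; rewrite card_eq_le => /andP[].
pose g (e : option 'I_n) : location broom :=
  xget (origin broom) (@on_arc R broom_graph e (r - base e)).
apply: card_le_trans (_ : _ #<= g @` setT)%card (card_image_le _ _).
apply: subset_card_le => x /=; rewrite broom_dist => xr.
have [e [a [ex _ _ _]]] := depth_param x.
exists e => //; have := depth_arc ex; rewrite xr => ra.
have {}ex : @on_arc R broom_graph e (r - base e) x.
  by rewrite ra addrAC subrr add0r.
by apply/esym/(on_arc_inj ex); apply: xgetPex; exists x.
Qed.

Section Sweep.
Variable p : 'I_n -> 'I_n.
Hypothesis p_inj : injective p.

Lemma sweep0 : sweep (start p) 0 = [set origin broom].
Proof.
apply/seteqP; split=> [x x0|x ->]; last by rewrite /sweep/=.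
apply: contrapT => /(@height_gt0 (start p) erefl (start_ge1 p)).
by rewrite ltNge x0.
Qed.

Let broom_network_length : network_length broom = (1 + n%:R * eps)%:E.
Proof. exact: broom_length. Qed.

Lemma sweep_mono (t t' : R) : 0 <= t -> t <= t' ->
  (t'%:E <= network_length broom)%E -> sweep (start p) t `<=` sweep (start p) t'.
Proof. by move=> _ tt _ x; rewrite /sweep/= => /le_trans; apply. Qed.

Lemma sweep_connected_upto (t : R) : 0 <= t -> (t%:E <= network_length broom)%E ->
  connected (sweep (start p) t : set (location broom)).
Proof. by move=> t0 _; exact: (sweep_connected erefl (start_ge1 p)). Qed.

Lemma sweep_length_upto (t : R) : 0 <= t -> (t%:E <= network_length broom)%E ->
  total_length (sweep (start p) t : set (location broom)) = t%:E.
Proof.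
by rewrite broom_network_length lee_fin; exact: sweep_length.
Qed.

Definition sweep_search : search broom :=
  @Search R broom (sweep (start p)) sweep0 sweep_mono
    sweep_connected_upto sweep_length_upto.

Lemma sweep_time H : (search_time sweep_search H <= (height (start p) H)%:E)%E.
Proof.
apply: ereal_inf_lbound; exists (height (start p) H) => //; split.
- exact: (@height_ge0 (start p) erefl (start_ge1 p)).
- by rewrite broom_network_length lee_fin start_height_le.
- by rewrite /= /sweep/=.
Qed.

End Sweep.

End Broom.

Local Open Scope ereal_scope.

(** * The two ratios of a broom *)

Section BroomRatios.
Variables (R : realType) (n : nat) (eps : R) (eps_gt0 : (0 < eps)%R).

Let B : network R := @broom R n eps eps_gt0.
Let n_eps_ge0 : (0 <= n%:R * eps)%R.
Proof. by rewrite mulr_ge0// ltW. Qed.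

Lemma depth_gt0 (H : location B) : H <> origin B -> (0 < depth H)%R.
Proof. by apply: height_gt0 => // -[]. Qed.

Lemma depth_le (H : location B) : (depth H <= 1 + eps)%R.
Proof.
have e0 := ltW eps_gt0.
have [e [a [_ -> a0 al]]] := depth_param H.
by case: e al => [i|] /= al; rewrite ?lerD2l// add0r (le_trans al)// lerDl.
Qed.

Lemma broom_normalized_time_le (S : search B) H (c : R) : (0 <= c)%R ->
  (normalized_time S H <= c%:E) =
  ((H == origin B) || (search_time S H <= (c * depth H)%:E)).
Proof.
move=> c0; rewrite /normalized_time; case: eqP => [_|/depth_gt0 d0] /=.
  by rewrite lee_fin.
by rewrite broom_dist lee_pdivrMr// EFinM.
Qed.

Lemma normalized_time_le_ratio S (c : R) :
  ereal_sup [set normalized_time S H | H in [set: location B]] <= c%:E ->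
  forall H, normalized_time S H <= c%:E.
Proof. by move=> /ereal_supP h H; apply: h; exists H. Qed.

(** If the ratio were smaller, the whole broom would be explored at a time t less
    than its length. *)
Lemma broom_deterministic_ge :
  ((1 + n%:R * eps) / (1 + eps))%:E <= deterministic_ratio B.
Proof.
have D0 : (0 < 1 + eps)%R by rewrite addr_gt0.
apply: le_ereal_inf_tmp => _ [S _ <-]; rewrite leNgt; apply/negP => slt.
have [c [c0 sc clt]] : exists c : R, [/\ (0 <= c)%R,
    forall H, normalized_time S H <= c%:E & (c * (1 + eps) < 1 + n%:R * eps)%R].
  have s0 : 0 <= ereal_sup [set normalized_time S H | H in [set: location B]].
    apply: le_ereal_sup_tmp; exists (normalized_time S (origin B)).
      by exists (origin B).
    exact: normalized_time_ge0.
  case E : (ereal_sup _) s0 slt => [c| |]//; rewrite lee_fin lte_fin => c0.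
  rewrite ltr_pdivlMr// => clt; exists c; split=> //.
  by apply: normalized_time_le_ratio; rewrite E.
pose t := ((c * (1 + eps) + (1 + n%:R * eps)) / 2)%R.
have ct : (c * (1 + eps) < t)%R by rewrite midf_lt.
have tn : (t < 1 + n%:R * eps)%R by rewrite midf_lt.
have t0 : (0 <= t)%R by apply: le_trans (ltW ct); rewrite mulr_ge0// ltW.
have netE : network_length B = (1 + n%:R * eps)%:E by exact: broom_length.
have tQ : t%:E <= network_length B by rewrite netE lee_fin ltW.
have StT : S t = [set: location B].
  apply/seteqP; split=> // H _; have := sc H.
  rewrite broom_normalized_time_le// => /predU1P[->|hH].
    exact: explored_origin.
  have : search_time S H < t%:E.
    apply: le_lt_trans hH _; rewrite lte_fin; apply: le_lt_trans ct.
    by rewrite ler_wpM2l// depth_le.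
  move=> /search_time_lt[u [u0 uQ ut Su]].
  by apply: (explored_mono u0 _ tQ) Su; exact: ltW.
have := explored_length S t0 tQ; rewrite StT broom_length => -[] e.
by move: tn; rewrite e ltxx.
Qed.

(** A connected set that contains the root and the hub contains the handle, so
    that no search finds the hub before time 1. *)
Lemma broom_randomized_ge1 : 1 <= randomized_ratio B.
Proof.
pose hub : location B := AtVertex (Some None : vertex (broom_graph n eps_gt0)).
apply: le_ereal_inf_tmp => _ [s _ <-].
apply: le_ereal_sup_tmp; exists (expected_time s hub); first by exists hub.
have hub_ge S : 1 <= normalized_time S hub.
  rewrite /normalized_time; case: eqP => [//|_].
  rewrite broom_dist /depth /= add0r invr1 mule1.
  apply: le_ereal_inf_tmp => _ [t [t0 tQ St] <-].
  rewrite -(explored_length S t0 tQ).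
  have cS := @explored_connected _ _ S _ t0 tQ.
  have So := @explored_origin _ _ S _ t0 tQ.
  apply: le_trans (total_length_ge (S t) (s := [:: None : arc B]) isT).
  rewrite big_seq1; have -> : 1 = @lebesgue_measure R `]0%R, 1%R[%classic.
    by rewrite lebesgue_measure_itv/= lte_fin ltr01 oppr0 adde0.
  apply: le_measure; rewrite ?inE//; first exact: trace_measurable cS So.
  move=> a; rewrite /= in_itv/= => /andP[a0 a1].
  have [|z Sz za] := connected_attains (depth_lipschitz (n := n) (eps_gt0 := eps_gt0))
    cS So St (c := a).
    by rewrite /depth/= add0r (ltW a0) (ltW a1).
  split=> //; exists z => //.
  have [e [b [ez hz b0 bl]]] := depth_param z.
  move: za; rewrite hz => za; case: e ez za {hz bl} => [i|] ez za.
    by move: a1; rewrite -za ltNge lerDl b0.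
  by rewrite -za add0r.
have -> : 1 = \int[search_law s]_S cst (1 : \bar R) S.
  rewrite integral_cst// mul1e; apply/esym; exact: (probability_setT (search_law s)).
apply: ge0_le_integral => //; exact: measurable_normalized_time.
Qed.

Let forward : search B := sweep_search eps_gt0 (@inj_id 'I_n).
Let backward : search B := sweep_search eps_gt0 (@rev_ord_inj n).

(** A bristle of rank i in one order has rank n - 1 - i in the reverse one: the
    two search times of a point at distance d add up to at most 2 d + n eps on
    a bristle, where d >= 1, and to 2 d on the handle. *)
Lemma broom_randomized_le : randomized_ratio B <= (1 + n%:R * eps / 2)%:E.
Proof.
have c0 : (0 <= 1 + n%:R * eps / 2)%R by rewrite addr_ge0// divr_ge0.
apply: ge_ereal_inf.
exists (ereal_sup [set expected_time (coin_search forward backward) H |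
  H in [set: location B]]); first by exists (coin_search forward backward).
apply: ge_ereal_sup => _ [H _ <-]; rewrite expected_coin_search.
rewrite /normalized_time; case: eqP => [_|/depth_gt0 d0].
  by rewrite adde0 mule0 lee_fin.
rewrite broom_dist -ge0_muleDl ?search_time_ge0// muleA lee_pdivrMr//.
apply: (@le_trans _ _ ((2^-1)%:E * ((height (start eps id) H)%:E +
    (height (start eps (@rev_ord n)) H)%:E))).
  rewrite lee_wpmul2l ?lee_fin//; apply: leeD; exact: sweep_time.
rewrite -EFinD -!EFinM lee_fin.
suff : (height (start eps id) H + height (start eps (@rev_ord n)) H <=
    2 * depth H + n%:R * eps * depth H)%R by lra.
have key (e : arc B) (a : R) : (0 <= a)%R ->
    (start eps id e + a + (start eps (@rev_ord n) e + a) <=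
     2 * (base R e + a) + n%:R * eps * (base R e + a))%R.
  case: e => [i|] a0 /=; last by have := mulr_ge0 n_eps_ge0 a0; lra.
  have -> : ((n - i.+1)%:R = n%:R - i%:R - 1 :> R)%R.
    by rewrite natrB// -natr1 opprD addrA.
  by have := mulr_ge0 n_eps_ge0 a0; have := eps_gt0; lra.
case: H {d0} => [[e|]|e a a0 al] /=.
- by apply: key; exact: ltW (broom_len_gt0 eps_gt0 _).
- by rewrite /depth/= !mulr0 !addr0.
- by apply: key; exact: ltW.
Qed.

End BroomRatios.

(** The value 1 for the length of the bristles is a dummy: there are none. *)
Lemma segment_deterministic_le (R : realType) :
  deterministic_ratio (@broom R 0 1 ltr01) <= 1.
Proof.
set B := broom _ _; pose S : search B := sweep_search ltr01 (@inj_id 'I_0).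
apply: ge_ereal_inf.
exists (ereal_sup [set normalized_time S H | H in [set: location B]]).
  by exists S.
apply: ge_ereal_sup => _ [H _ <-]; rewrite broom_normalized_time_le//.
apply/orP; right; apply: (le_trans (sweep_time _ _)); rewrite lee_fin mul1r.
by case: H => [[[[]//|]|]|[[]//|]].
Qed.

Theorem proposition7 (R : realType) :
  [/\ forall Q : network R, bounded_spheres Q ->
        (2^-1)%:E * deterministic_ratio Q <= randomized_ratio Q /\
        randomized_ratio Q <= deterministic_ratio Q,
      forall c : R,
        (forall Q : network R, bounded_spheres Q ->
           c%:E * deterministic_ratio Q <= randomized_ratio Q) ->
        (c <= 2^-1)%R
    & forall c : R,
        (forall Q : network R, bounded_spheres Q ->
           randomized_ratio Q <= c%:E * deterministic_ratio Q) ->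
        (1 <= c)%R].
Proof.
split=> [Q bQ|c hc|c hc].
- split; first exact: half_deterministic_le_randomized.
  exact: randomized_ratio_le_deterministic.
- rewrite leNgt; apply/negP => c2.
  have c0 : (0 < c)%R by apply: lt_trans c2; rewrite invr_gt0.
  (* for n = m ^ 2 and eps = 1 / m, c m <= 1 + m / 2 forces m (c - 1/2) <= 1 *)
  pose m := (Num.truncn (c - 2^-1)^-1).+1.
  have m0 : (0 < m%:R :> R)%R by rewrite ltr0n.
  have mc : (1 < m%:R * (c - 2^-1))%R.
    by rewrite -ltr_pdivrMr ?subr_gt0// mul1r truncnS_gt.
  have i0 : (0 < m%:R^-1 :> R)%R by rewrite invr_gt0.
  have mmE : ((m * m)%:R * m%:R^-1 = m%:R :> R)%R by rewrite natrM mulfK ?gt_eqF.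
  have := hc _ (@broom_bounded_spheres R (m * m) _ i0).
  have ge_m : m%:R%:E <= deterministic_ratio (@broom R (m * m) _ i0).
    apply: le_trans (broom_deterministic_ge (m * m) i0); rewrite mmE lee_fin.
    rewrite ler_pdivlMr ?addr_gt0// mulrDr mulr1 divff ?gt_eqF//.
    by rewrite addrC.
  move=> /(le_trans (lee_wpmul2l (ltW (_ : 0 < c%:E)) ge_m)) h.
  have := le_trans (h _) (broom_randomized_le (m * m) i0).
  rewrite mmE -EFinM !lee_fin lte_fin => /(_ c0); move: mc; lra.
have := hc _ (@broom_bounded_spheres R 0 _ ltr01).
have d1 : deterministic_ratio (@broom R 0 _ ltr01) = 1.
  apply/eqP; rewrite eq_le segment_deterministic_le/=.
  apply: le_trans (randomized_ratio_le_deterministic _).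
  exact: broom_randomized_ge1.
rewrite d1 mule1 => /(le_trans (broom_randomized_ge1 0 ltr01)).
by rewrite lee_fin.
Qed.
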